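(* There is no minimum transitive model of $\mathsf{KM}$. Moreover, for every real $r\subseteq\omega$ there is no minimum transitive model of $\mathsf{KM}$ among those transitive models $(M,\mathcal X)\models\mathsf{KM}$ with $r\in M$. Indeed, the same holds with $\mathsf{KM}$ replaced by any theory $T$ extending $\mathsf{GB}+\Pi^1_1\text{-}\mathsf{CA}$ with the property that $T$ (as a set of Gödel codes) is an element of $M$ for every transitive model $(M,\mathcal X)$ of $T$; in particular it holds for any computably axiomatizable extension $T$ of $\mathsf{GB}+\Pi^1_1\text{-}\mathsf{CA}$.
   Context: Models of second-order set theory are pairs $(M,\mathcal X)$ with $M$ a model of set theory and $\mathcal X\subseteq\mathcal P(M)$ the classes. $\mathsf{GB}$ consists of $\mathsf{ZF}$ for sets, Extensionality for classes, Class Replacement (the image of a set under a class function is a set), and Elementary Comprehension (comprehension for formulas without class quantifiers, with set and class parameters). $\Pi^1_1\text{-}\mathsf{CA}$ is the comprehension schema for formulas of the form $\forall X\,\varphi$ with $\varphi$ having no class quantifiers (set and class parameters allowed). $\mathsf{KM}$ (Kelley–Morse) is $\mathsf{GB}$ with comprehension for all second-order formulas. A model $(M,\mathcal X)$ is transitive if $M$ is a transitive set with the true membership relation. A minimum transitive model of $T$ containing $r$ is a transitive $(M,\mathcal X)\models T$ with $r\in M$ such that for every transitive $(N,\mathcal Y)\models T$ with $r\in N$ we have $M\subseteq N$ and $\mathcal X\subseteq\mathcal Y$. *)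

(* Defs.v *)
(* Stdlib *)
From Stdlib Require Import Arith List Cantor.
Import ListNotations.

Set Implicit Arguments.

(** * The ambient universe of sets

    Well-founded trees modulo bisimulation.  With classical logic and choice in
    the metatheory this is a model of (second-order) ZFC, and it plays the role
    of V. *)

Inductive tree : Type := sup (A : Type) (f : A -> tree).

Fixpoint teq (x y : tree) {struct x} : Prop :=
  match x, y with
  | sup f, sup g =>
      (forall a, exists b, teq (f a) (g b)) /\
      (forall b, exists a, teq (f a) (g b))
  end.

Definition tmem (x y : tree) : Prop :=
  match y with sup g => exists b, teq x (g b) end.

(* An element is an equivalence class of [teq], so that [=] on [V] is equality
   of sets. *)
Definition V : Type := { P : tree -> Prop | exists x, P = teq x }.

Definition cls (x : tree) : V := exist _ (teq x) (ex_intro _ x eq_refl).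

Definition mem (x y : V) : Prop :=
  exists a b, proj1_sig x a /\ proj1_sig y b /\ tmem a b.

Declare Scope V_scope.
Delimit Scope V_scope with V.
Bind Scope V_scope with V.
Open Scope V_scope.

Notation "x ∈ y" := (mem x y) (at level 70, no associativity) : V_scope.

Definition subset (x y : V) : Prop := forall z, z ∈ x -> z ∈ y.

Notation "x ⊆ y" := (subset x y) (at level 70, no associativity) : V_scope.

Definition transitive_set (x : V) : Prop := forall y, y ∈ x -> y ⊆ x.

Definition tempty : tree := sup (fun e : False => match e return tree with end).

(* x ∪ {x} *)
Definition tsucc (x : tree) : tree :=
  match x with
  | @sup A f => sup (fun o : option A => match o with Some a => f a | None => x end)
  end.

Fixpoint tnum (n : nat) : tree :=
  match n with 0 => tempty | S k => tsucc (tnum k) end.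

Definition omega : V := cls (sup tnum).

(* The set of (von Neumann) natural numbers satisfying [P]. *)
Definition nat_set (P : nat -> Prop) : V :=
  cls (sup (fun n : { n : nat | P n } => tnum (proj1_sig n))).

(** * The two-sorted language of second-order set theory

    Set variables and class variables are two separate families of names, each
    indexed by [nat]. *)

Inductive form : Type :=
| EqS (x y : nat)          (* x = y, sets *)
| EqC (X Y : nat)          (* X = Y, classes *)
| Mem (x y : nat)          (* x ∈ y, both sets *)
| MemC (x X : nat)         (* x ∈ X, a set in a class *)
| Bot
| Imp (p q : form)
| ForallS (x : nat) (p : form)
| ForallC (X : nat) (p : form).

Definition Not (p : form) : form := Imp p Bot.
Definition Or (p q : form) : form := Imp (Not p) q.
Definition And (p q : form) : form := Not (Imp p (Not q)).
Definition Iff (p q : form) : form := And (Imp p q) (Imp q p).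
Definition ExistsS (x : nat) (p : form) : form := Not (ForallS x (Not p)).
Definition ExistsC (X : nat) (p : form) : form := Not (ForallC X (Not p)).

Fixpoint fvS (p : form) : list nat :=
  match p with
  | EqS x y | Mem x y => [x; y]
  | MemC x _ => [x]
  | EqC _ _ | Bot => []
  | Imp p q => fvS p ++ fvS q
  | ForallS x p => remove Nat.eq_dec x (fvS p)
  | ForallC _ p => fvS p
  end.

Fixpoint fvC (p : form) : list nat :=
  match p with
  | EqC X Y => [X; Y]
  | MemC _ X => [X]
  | EqS _ _ | Mem _ _ | Bot => []
  | Imp p q => fvC p ++ fvC q
  | ForallS _ p => fvC p
  | ForallC X p => remove Nat.eq_dec X (fvC p)
  end.

Definition sentence (p : form) : Prop := fvS p = [] /\ fvC p = [].

(* Universal closure. *)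
Definition close (p : form) : form :=
  fold_right ForallS (fold_right ForallC p (fvC p)) (fvS p).

(* No class quantifiers; class variables may occur as parameters. *)
Fixpoint elementary (p : form) : Prop :=
  match p with
  | EqS _ _ | EqC _ _ | Mem _ _ | MemC _ _ | Bot => True
  | Imp p q => elementary p /\ elementary q
  | ForallS _ p => elementary p
  | ForallC _ _ => False
  end.

(* Formulas of the one-sorted language of set theory. *)
Definition set_form (p : form) : Prop := elementary p /\ fvC p = [].

(** * Structures and satisfaction *)

Record structure : Type := Structure {
  set_dom : Type;
  class_dom : Type;
  mem_set : set_dom -> set_dom -> Prop;
  mem_class : set_dom -> class_dom -> Prop
}.

Definition upd (A : Type) (s : nat -> A) (i : nat) (a : A) : nat -> A :=
  fun j => if Nat.eqb i j then a else s j.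

Fixpoint sat (S : structure) (s : nat -> set_dom S) (c : nat -> class_dom S)
    (p : form) : Prop :=
  match p with
  | EqS x y => s x = s y
  | EqC X Y => c X = c Y
  | Mem x y => mem_set S (s x) (s y)
  | MemC x X => mem_class S (s x) (c X)
  | Bot => False
  | Imp p q => sat S s c p -> sat S s c q
  | ForallS x p => forall a, sat S (upd s x a) c p
  | ForallC X p => forall A, sat S s (upd c X A) p
  end.

Definition holds (S : structure) (p : form) : Prop := forall s c, sat S s c p.

(* As usual in first-order logic, the domains of a model are nonempty. *)
Definition models (S : structure) (T : form -> Prop) : Prop :=
  inhabited (set_dom S) /\ inhabited (class_dom S) /\
  forall p, T p -> holds S p.

Definition theory (T : form -> Prop) : Prop := forall p, T p -> sentence p.

Definition consequence (T : form -> Prop) (p : form) : Prop :=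
  forall S, models S T -> holds S p.

Definition extends (T U : form -> Prop) : Prop :=
  forall p, U p -> consequence T p.

(** * Axioms *)

Definition ax_extensionality : form :=
  ForallS 0 (ForallS 1 (Imp (ForallS 2 (Iff (Mem 2 0) (Mem 2 1))) (EqS 0 1))).

Definition ax_foundation : form :=
  ForallS 0 (Imp (ExistsS 1 (Mem 1 0))
    (ExistsS 1 (And (Mem 1 0) (Not (ExistsS 2 (And (Mem 2 0) (Mem 2 1))))))).

Definition ax_pairing : form :=
  ForallS 0 (ForallS 1 (ExistsS 2 (ForallS 3 (Iff (Mem 3 2) (Or (EqS 3 0) (EqS 3 1)))))).

Definition ax_union : form :=
  ForallS 0 (ExistsS 1 (ForallS 2 (Iff (Mem 2 1) (ExistsS 3 (And (Mem 2 3) (Mem 3 0)))))).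

Definition ax_powerset : form :=
  ForallS 0 (ExistsS 1 (ForallS 2 (Iff (Mem 2 1) (ForallS 3 (Imp (Mem 3 2) (Mem 3 0)))))).

Definition ax_infinity : form :=
  ExistsS 0 (And
    (ExistsS 1 (And (Mem 1 0) (ForallS 2 (Not (Mem 2 1)))))
    (ForallS 1 (Imp (Mem 1 0)
      (ExistsS 2 (And (Mem 2 0) (ForallS 3 (Iff (Mem 3 2) (Or (Mem 3 1) (EqS 3 1))))))))).

(* ∃b ∀x (x ∈ b ↔ x ∈ a ∧ p(x)) *)
Definition separation_body (x a b : nat) (p : form) : form :=
  ExistsS b (ForallS x (Iff (Mem x b) (And (Mem x a) p))).

(* If for each x ∈ a there is at most one y with p(x,y), then
   ∃b ∀y (y ∈ b ↔ ∃x ∈ a p(x,y)).  "At most one" is written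
   ∃z ∀y (p(x,y) → y = z), which avoids substitution. *)
Definition replacement_body (x y z a b : nat) (p : form) : form :=
  Imp (ForallS x (Imp (Mem x a) (ExistsS z (ForallS y (Imp p (EqS y z))))))
      (ExistsS b (ForallS y (Iff (Mem y b) (ExistsS x (And (Mem x a) p))))).

Inductive ZF : form -> Prop :=
| ZF_extensionality : ZF ax_extensionality
| ZF_foundation : ZF ax_foundation
| ZF_pairing : ZF ax_pairing
| ZF_union : ZF ax_union
| ZF_powerset : ZF ax_powerset
| ZF_infinity : ZF ax_infinity
| ZF_separation : forall x a b p,
    set_form p -> NoDup [x; a; b] -> ~ In b (fvS p) ->
    ZF (close (separation_body x a b p))
| ZF_replacement : forall x y z a b p,
    set_form p -> NoDup [x; y; z; a; b] -> ~ In z (fvS p) -> ~ In b (fvS p) ->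
    ZF (close (replacement_body x y z a b p)).

Definition ax_class_extensionality : form :=
  ForallC 0 (ForallC 1 (Imp (ForallS 0 (Iff (MemC 0 0) (MemC 0 1))) (EqC 0 1))).

(* p is the Kuratowski pair {{x},{x,y}}; the bound names 10, 11 must differ from
   p, x, y. *)
Definition is_pair (p x y : nat) : form :=
  ForallS 10 (Iff (Mem 10 p)
    (Or (ForallS 11 (Iff (Mem 11 10) (EqS 11 x)))
        (ForallS 11 (Iff (Mem 11 10) (Or (EqS 11 x) (EqS 11 y)))))).

(* (x,y) ∈ F; the bound name 9 must differ from x, y. *)
Definition pair_in (x y F : nat) : form :=
  ExistsS 9 (And (is_pair 9 x y) (MemC 9 F)).

Definition class_function (F : nat) : form :=
  And (ForallS 0 (Imp (MemC 0 F) (ExistsS 1 (ExistsS 2 (is_pair 0 1 2)))))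
      (ForallS 0 (ForallS 1 (ForallS 2
        (Imp (And (pair_in 0 1 F) (pair_in 0 2 F)) (EqS 1 2))))).

Definition ax_class_replacement : form :=
  ForallC 0 (Imp (class_function 0)
    (ForallS 0 (ExistsS 1 (ForallS 2
      (Iff (Mem 2 1) (ExistsS 3 (And (Mem 3 0) (pair_in 3 2 0)))))))).

(* The comprehension schema for the formulas in [Phi], with set and class
   parameters. *)
Inductive comprehension (Phi : form -> Prop) : form -> Prop :=
| comprehension_intro : forall x X p,
    Phi p -> ~ In X (fvC p) ->
    comprehension Phi (close (ExistsC X (ForallS x (Iff (MemC x X) p)))).

Inductive GB : form -> Prop :=
| GB_ZF : forall p, ZF p -> GB p
| GB_class_extensionality : GB ax_class_extensionality
| GB_class_replacement : GB ax_class_replacement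
| GB_comprehension : forall p, comprehension elementary p -> GB p.

Inductive Pi11 : form -> Prop :=
| Pi11_intro : forall X p, elementary p -> Pi11 (ForallC X p).

Definition GB_Pi11_CA (p : form) : Prop := GB p \/ comprehension Pi11 p.

Definition KM (p : form) : Prop := GB p \/ comprehension (fun _ => True) p.

(** * Gödel codes and computable axiomatizability *)

Fixpoint code (p : form) : nat :=
  match p with
  | EqS x y => to_nat (0, to_nat (x, y))
  | EqC X Y => to_nat (1, to_nat (X, Y))
  | Mem x y => to_nat (2, to_nat (x, y))
  | MemC x X => to_nat (3, to_nat (x, X))
  | Bot => to_nat (4, 0)
  | Imp p q => to_nat (5, to_nat (code p, code q))
  | ForallS x p => to_nat (6, to_nat (x, code p))
  | ForallC X p => to_nat (7, to_nat (X, code p))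
  end.

Definition codes (T : form -> Prop) (n : nat) : Prop :=
  exists p, T p /\ code p = n.

Definition code_set (T : form -> Prop) : V := nat_set (codes T).

(* Kleene's μ-recursive functions, with arguments given as a list. *)
Inductive murec : Type :=
| Zero
| Succ
| Proj (i : nat)
| Comp (f : murec) (gs : list murec)
| PrimRec (f g : murec)
| Mu (f : murec).

Inductive evals : murec -> list nat -> nat -> Prop :=
| ev_zero : forall v, evals Zero v 0
| ev_succ : forall x v, evals Succ (x :: v) (S x)
| ev_proj : forall i v x, nth_error v i = Some x -> evals (Proj i) v x
| ev_comp : forall f gs v ys z,
    Forall2 (fun g y => evals g v y) gs ys -> evals f ys z ->
    evals (Comp f gs) v z
| ev_prim0 : forall f g v z, evals f v z -> evals (PrimRec f g) (0 :: v) z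
| ev_primS : forall f g n v y z,
    evals (PrimRec f g) (n :: v) y -> evals g (n :: y :: v) z ->
    evals (PrimRec f g) (S n :: v) z
| ev_mu : forall f v n (h : nat -> nat),
    (forall m, m < n -> evals f (m :: v) (S (h m))) -> evals f (n :: v) 0 ->
    evals (Mu f) v n.

Definition computable (P : nat -> Prop) : Prop :=
  exists f, forall n, (P n -> evals f [n] 1) /\ (~ P n -> evals f [n] 0).

Definition computably_axiomatizable (T : form -> Prop) : Prop :=
  exists A, theory A /\ computable (codes A) /\
    forall p, sentence p -> (consequence A p <-> consequence T p).

(** * Transitive models *)

Definition standard_structure (M X : V) : structure :=
  {| set_dom := { x : V | x ∈ M };
     class_dom := { A : V | A ∈ X };
     mem_set x y := proj1_sig x ∈ proj1_sig y;
     mem_class x A := proj1_sig x ∈ proj1_sig A |}.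

Definition transitive_model (T : form -> Prop) (M X : V) : Prop :=
  transitive_set M /\ (forall A, A ∈ X -> A ⊆ M) /\
  models (standard_structure M X) T.

Definition minimum_transitive_model (T : form -> Prop) (M X : V) : Prop :=
  transitive_model T M X /\
  forall N Y, transitive_model T N Y -> M ⊆ N /\ X ⊆ Y.

Definition minimum_transitive_model_containing
    (T : form -> Prop) (r M X : V) : Prop :=
  transitive_model T M X /\ r ∈ M /\
  forall N Y, transitive_model T N Y -> r ∈ N -> M ⊆ N /\ X ⊆ Y.

Definition no_minimum_transitive_model (T : form -> Prop) : Prop :=
  ~ exists M X, minimum_transitive_model T M X.

Definition no_minimum_transitive_model_containing
    (T : form -> Prop) (r : V) : Prop :=
  ~ exists M X, minimum_transitive_model_containing T r M X.

(* Main.v *)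
From Stdlib Require Import Arith List Cantor Lia Classical ClassicalEpsilon
  FunctionalExtensionality PropExtensionality ProofIrrelevance.
Require Import Defs.
Import ListNotations.

Set Implicit Arguments.

(** A minimum model (M, X) is countable, by Löwenheim–Skolem and the Mostowski collapse, so
    it suffices to find a model (M, Y) of T that omits some class of X.

    Consider the infinitary propositional theory of models (M, Y) of T whose classes are
    named by elements of M: a condition is a finite set of literals, and a condition s is
    refuted if for some clause every extension of s by a literal of the clause is.  An
    unrefuted condition extends to a model, since M is countable.  Let A be a class such
    that every extension of s deciding membership in the class named m against A is
    refuted; then A is the set of those a for which s ∪ {a ∉ m} is refuted.

    The true set of refuted conditions need not belong to X.  But Π¹₁-CA puts into X the
    comparison of stages of refutation in the sense of X, and for an unrefuted s every
    truly refuted q precedes s in it, while s ∪ {a ∈ m} and s ∪ {a ∉ m} cannot both precede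
    s by two stages.  So one class of X uniformly contains all classes that cannot be
    omitted at some (s, m), and its diagonal is a class of X that can be omitted. *)

(** The fixed point computed in X is least only among the classes of X. Since (M, X) may take
    ill-founded relations for well-founded ones, it can contain conditions that are not truly
    refuted. Comparison with an unrefuted s is immune to this: a truly refuted q precedes s by
    induction on its true refutation, while asymmetry of strict precedence is proved by induction
    inside X, for relations elementary in its classes. Two stages are needed because of the cut
    clause {a ∈ m, a ∉ m}: a condition two stages before s is strictly before one of the two
    premises of s under this clause, so if both premises were two stages before s, strict precedence
    would have a cycle.

    A class quantifier becomes an infinitary conjunction over names, so the clauses are elementary
    over M as soon as the codes of the axioms form an element of M; this is what the hypothesis on T
    provides. The empty condition is unrefuted because X is countable: with its classes named by
    numerals, (M, X) itself satisfies all clauses. *)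

(** * Sets as trees up to bisimulation *)

Lemma teq_refl x : teq x x.
Proof. induction x as [A f IH]; simpl; split; intros a; exists a; apply IH. Qed.

Lemma teq_sym x : forall y, teq x y -> teq y x.
Proof.
  induction x as [A f IH]; intros [B g] [H1 H2]; simpl; split.
  - intros b; destruct (H2 b) as [a Ha]; exists a; auto.
  - intros a; destruct (H1 a) as [b Hb]; exists b; auto.
Qed.

Lemma teq_trans x : forall y z, teq x y -> teq y z -> teq x z.
Proof.
  induction x as [A f IH]; intros [B g] [C h] [H1 H2] [H3 H4]; simpl; split.
  - intros a; destruct (H1 a) as [b Hb]; destruct (H3 b) as [c Hc]; exists c; eauto.
  - intros c; destruct (H4 c) as [b Hb]; destruct (H2 b) as [a Ha]; exists a; eauto.
Qed.

Lemma sig_eq (A : Type) (P : A -> Prop) (x y : {a | P a}) :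
  proj1_sig x = proj1_sig y -> x = y.
Proof.
  destruct x as [x p], y as [y q]; simpl; intros <-; f_equal; apply proof_irrelevance.
Qed.

Lemma cls_eq x y : cls x = cls y <-> teq x y.
Proof.
  split; intros H.
  - apply (f_equal (@proj1_sig _ _)) in H; simpl in H.
    rewrite H; apply teq_refl.
  - apply sig_eq; simpl; extensionality z; apply propositional_extensionality.
    split; intros; eauto using teq_trans, teq_sym.
Qed.

Lemma rep_exists (x : V) : exists t, x = cls t.
Proof. destruct x as [P [t ->]]; exists t; reflexivity. Qed.

Definition rep (x : V) : tree := epsilon (inhabits tempty) (fun t => x = cls t).

Lemma repK x : cls (rep x) = x.
Proof.
  symmetry; exact (epsilon_spec (inhabits tempty) (fun t => x = cls t) (rep_exists x)).
Qed.

Lemma mem_cls x A (f : A -> tree) : mem x (cls (sup f)) <-> exists a, x = cls (f a).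
Proof.
  destruct (rep_exists x) as [t ->]; split.
  - intros (u & [B g] & Hu & [H1 H2] & b & Hb); simpl in *.
    destruct (H2 b) as [a Ha]; exists a; apply cls_eq; eauto using teq_trans, teq_sym.
  - intros [a Ha%cls_eq]; exists t, (sup f); repeat split; try apply teq_refl;
      try (intros b; exists b; apply teq_refl).
    exists a; exact Ha.
Qed.

Lemma set_ext x y : (forall z, z ∈ x <-> z ∈ y) -> x = y.
Proof.
  destruct (rep_exists x) as [[A f] ->], (rep_exists y) as [[B g] ->]; intros H.
  apply cls_eq; simpl; split.
  - intros a; destruct (proj1 (mem_cls (cls (f a)) g)) as [b Hb].
    + apply H, mem_cls; exists a; reflexivity.
    + exists b; apply cls_eq, Hb.
  - intros b; destruct (proj1 (mem_cls (cls (g b)) f)) as [a Ha].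
    + apply H, mem_cls; exists b; reflexivity.
    + exists a; apply cls_eq; auto.
Qed.

Lemma mem_induction (P : V -> Prop) :
  (forall x, (forall y, y ∈ x -> P y) -> P x) -> forall x, P x.
Proof.
  intros H x; destruct (rep_exists x) as [t ->].
  induction t as [A f IH]; apply H; intros y [a ->]%mem_cls; apply IH.
Qed.

Lemma mem_irrefl x : ~ x ∈ x.
Proof. induction x as [x IH] using mem_induction; intros H; exact (IH x H H). Qed.

Lemma mem_asym x : forall y, x ∈ y -> ~ y ∈ x.
Proof.
  induction x as [x IH] using mem_induction; intros y H H'; exact (IH y H' x H' H).
Qed.

Lemma separation_exists (x : V) (P : V -> Prop) :
  exists y, forall z, z ∈ y <-> z ∈ x /\ P z.
Proof.
  destruct (rep_exists x) as [[A f] ->].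
  exists (cls (sup (fun a : {a : A | P (cls (f a))} => f (proj1_sig a)))); intros z.
  rewrite !mem_cls; split.
  - intros [[a Ha] ->]; simpl; eauto.
  - intros [[a ->] Ha]; exists (exist _ a Ha); reflexivity.
Qed.

Lemma image_exists (x : V) (F : V -> V) :
  exists y, forall z, z ∈ y <-> exists w, w ∈ x /\ z = F w.
Proof.
  destruct (rep_exists x) as [[A f] ->].
  exists (cls (sup (fun a => rep (F (cls (f a)))))); intros z.
  rewrite mem_cls; split.
  - intros [a ->]; exists (cls (f a)); rewrite repK, mem_cls; eauto.
  - intros (w & [a ->]%mem_cls & ->); exists a; rewrite repK; reflexivity.
Qed.

Definition num (n : nat) : V := cls (tnum n).

Lemma mem_num0 x : ~ x ∈ num 0.
Proof. intros [[] _]%mem_cls. Qed.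

Lemma mem_numS x n : x ∈ num (S n) <-> x ∈ num n \/ x = num n.
Proof.
  unfold num; simpl; destruct (tnum n) as [A f] eqn:E; simpl; rewrite !mem_cls; split.
  - intros [[a|] ->]; eauto.
  - intros [[a ->] | ->]; [exists (Some a) | exists None]; reflexivity.
Qed.

Lemma mem_omega x : x ∈ omega <-> exists n, x = num n.
Proof. apply mem_cls. Qed.

Lemma mem_nat_set x P : x ∈ nat_set P <-> exists n, P n /\ x = num n.
Proof.
  unfold nat_set; rewrite mem_cls; split.
  - intros [[n Hn] ->]; eauto.
  - intros (n & Hn & ->); exists (exist _ n Hn); reflexivity.
Qed.

Lemma mem_num x n : x ∈ num n <-> exists m, m < n /\ x = num m.
Proof.
  induction n as [|n IH].
  - split; [intros []%mem_num0 | intros (m & H & _); lia].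
  - rewrite mem_numS, IH; split.
    + intros [(m & H & ->) | ->]; [exists m | exists n]; split; auto.
    + intros (m & H & ->); destruct (Nat.eq_dec m n) as [-> | ]; [tauto | left].
      exists m; split; [lia | auto].
Qed.

Lemma num_inj m n : num m = num n -> m = n.
Proof.
  assert (H : forall a b, a < b -> num a <> num b).
  { intros a b Hab E; apply (@mem_irrefl (num b)); rewrite <- E at 1.
    apply mem_num; eauto. }
  intros E; destruct (Nat.lt_trichotomy m n) as [L | [L | L]]; auto;
    exfalso; eapply H; eauto.
Qed.

Lemma in_list_max l j : In j l -> j <= list_max l.
Proof.
  intros Hj; pose proof (proj1 (list_max_le l _) (le_n _)) as H.
  rewrite Forall_forall in H; auto.
Qed.

(** * Satisfaction *)

Section Sat.

Variable S : structure.

Lemma sat_Or s c p q : sat S s c (Or p q) <-> sat S s c p \/ sat S s c q.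
Proof. simpl; tauto. Qed.

Lemma sat_And s c p q : sat S s c (And p q) <-> sat S s c p /\ sat S s c q.
Proof. simpl; tauto. Qed.

Lemma sat_Iff s c p q : sat S s c (Iff p q) <-> (sat S s c p <-> sat S s c q).
Proof. unfold Iff; rewrite sat_And; reflexivity. Qed.

Lemma sat_ExistsS s c x p :
  sat S s c (ExistsS x p) <-> exists a, sat S (upd s x a) c p.
Proof.
  simpl; split.
  - intros H; apply NNPP; intros H'; apply H; intros a Ha; eauto.
  - intros [a Ha] H; exact (H a Ha).
Qed.

Lemma sat_ExistsC s c X p :
  sat S s c (ExistsC X p) <-> exists A, sat S s (upd c X A) p.
Proof.
  simpl; split.
  - intros H; apply NNPP; intros H'; apply H; intros a Ha; eauto.
  - intros [a Ha] H; exact (H a Ha).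
Qed.

Lemma upd_eq A (s : nat -> A) i a : upd s i a i = a.
Proof. unfold upd; rewrite Nat.eqb_refl; reflexivity. Qed.

Lemma upd_neq A (s : nat -> A) i j a : i <> j -> upd s i a j = s j.
Proof. unfold upd; intros H; apply Nat.eqb_neq in H; rewrite H; reflexivity. Qed.

Lemma upd_id A (s : nat -> A) i : upd s i (s i) = s.
Proof.
  extensionality j; unfold upd; destruct (Nat.eqb_spec i j); congruence.
Qed.

Lemma sat_agree p : forall s s' c c',
  (forall x, In x (fvS p) -> s x = s' x) -> (forall X, In X (fvC p) -> c X = c' X) ->
  sat S s c p <-> sat S s' c' p.
Proof.
  induction p as [x y|X Y|x y|x X| |p IHp q IHq|x p IHp|X p IHp];
    simpl; intros s s' c c' Hs Hc.
  - rewrite !Hs by auto; tauto.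
  - rewrite !Hc by auto; tauto.
  - rewrite !Hs by auto; tauto.
  - rewrite Hs, Hc by auto; tauto.
  - tauto.
  - rewrite (IHp s s' c c'), (IHq s s' c c'); try tauto;
      intros; (apply Hs || apply Hc); apply in_or_app; tauto.
  - assert (E : forall a, sat S (upd s x a) c p <-> sat S (upd s' x a) c' p).
    { intros a; apply IHp; auto; intros z Hz; unfold upd.
      destruct (Nat.eqb_spec x z); auto; apply Hs, in_in_remove; auto. }
    split; intros H a; apply E; auto.
  - assert (E : forall A, sat S s (upd c X A) p <-> sat S s' (upd c' X A) p).
    { intros A; apply IHp; auto; intros z Hz; unfold upd.
      destruct (Nat.eqb_spec X z); auto; apply Hc, in_in_remove; auto. }
    split; intros H A; apply E; auto.
Qed.

(** Quantifying over all assignments already closes a formula; repetitions in the lists of free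
    variables do no harm. *)
Lemma holds_close p : holds S (close p) <-> holds S p.
Proof.
  unfold close; split; intros H.
  - assert (H1 : holds S (fold_right ForallC p (fvC p))).
    { revert H; generalize (fold_right ForallC p (fvC p)); generalize (fvS p).
      intros l q; induction l as [|x l IH]; simpl; auto.
      intros H; apply IH; intros s c; specialize (H s c (s x)).
      rewrite upd_id in H; exact H. }
    revert H1; generalize (fvC p); intros l; induction l as [|X l IH]; simpl; auto.
    intros H1; apply IH; intros s c; specialize (H1 s c (c X)).
    rewrite upd_id in H1; exact H1.
  - assert (H1 : holds S (fold_right ForallC p (fvC p))).
    { generalize (fvC p); intros l; induction l as [|X l IH]; simpl; auto.
      intros s c A; apply IH. }
    generalize (fvS p); intros l; induction l as [|x l IH]; simpl; auto.
    intros s c a; apply IH.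
Qed.

End Sat.

(** * Renaming of variables *)

Fixpoint rename_class (f : nat -> nat) (p : form) : form :=
  match p with
  | EqS x y => EqS x y
  | EqC X Y => EqC (f X) (f Y)
  | Mem x y => Mem x y
  | MemC x X => MemC x (f X)
  | Bot => Bot
  | Imp p q => Imp (rename_class f p) (rename_class f q)
  | ForallS x p => ForallS x (rename_class f p)
  | ForallC X p => ForallC (f X) (rename_class f p)
  end.

Lemma elementary_rename_class f p : elementary p -> elementary (rename_class f p).
Proof. induction p; simpl; tauto. Qed.

(** [f] may identify variables: an elementary formula binds no class variable, so nothing is
    captured. *)
Lemma sat_rename_class S f p : elementary p -> forall s c,
  sat S s c (rename_class f p) <-> sat S s (fun X => c (f X)) p.
Proof.
  induction p as [x y|X Y|x y|x X| |p IHp q IHq|x p IHp|X p IHp];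
    simpl; intros E s c; try tauto.
  - rewrite IHp, IHq by tauto; tauto.
  - split; intros H a; apply IHp; auto.
Qed.

Fixpoint rename_set (f : nat -> nat) (p : form) : form :=
  match p with
  | EqS x y => EqS (f x) (f y)
  | EqC X Y => EqC X Y
  | Mem x y => Mem (f x) (f y)
  | MemC x X => MemC (f x) X
  | Bot => Bot
  | Imp p q => Imp (rename_set f p) (rename_set f q)
  | ForallS x p => ForallS (f x) (rename_set f p)
  | ForallC X p => ForallC X (rename_set f p)
  end.

Lemma elementary_rename_set f p : elementary p -> elementary (rename_set f p).
Proof. induction p; simpl; tauto. Qed.

Lemma sat_rename_set S f p : (forall i j, f i = f j -> i = j) -> forall s c,
  sat S s c (rename_set f p) <-> sat S (fun x => s (f x)) c p.
Proof.
  intros Hf.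
  induction p as [x y|X Y|x y|x X| |p IHp q IHq|x p IHp|X p IHp];
    simpl; intros s c; try tauto.
  - rewrite IHp, IHq by tauto; tauto.
  - assert (E : forall a, (fun z => upd s (f x) a (f z)) = upd (fun z => s (f z)) x a).
    { intros a; extensionality z; unfold upd.
      destruct (Nat.eqb_spec (f x) (f z)) as [e|n], (Nat.eqb_spec x z); auto.
      - apply Hf in e; congruence.
      - congruence. }
    split; intros H a; specialize (H a).
    + rewrite IHp, E in H; exact H.
    + rewrite IHp, E; exact H.
  - split; intros H A; specialize (H A); apply IHp; exact H.
Qed.

Lemma of_nat_S n : of_nat (S n) =
  match of_nat n with (S x, y) => (x, S y) | (0, y) => (S y, 0) end.
Proof. simpl; destruct (of_nat n) as [[|x] y]; reflexivity. Qed.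

Local Opaque to_nat of_nat.

(** * Decoding formulas *)

(* Numbers that code no formula are read as [Bot]. *)
Fixpoint dec (fuel n : nat) : form :=
  match fuel with
  | 0 => Bot
  | S k =>
      let (t, m) := of_nat n in
      let (a, b) := of_nat m in
      match t with
      | 0 => EqS a b
      | 1 => EqC a b
      | 2 => Mem a b
      | 3 => MemC a b
      | 5 => Imp (dec k a) (dec k b)
      | 6 => ForallS a (dec k b)
      | 7 => ForallC a (dec k b)
      | _ => Bot
      end
  end.

(** With a total decoder every natural number is a formula, and the model needs no predicate for
    being a code. *)
Definition decode (n : nat) : form := dec (S n) n.

Lemma to_nat_le a b : a + b <= to_nat (a, b).
Proof. pose proof (to_nat_non_decreasing a b); lia. Qed.

Lemma to_nat_lt t a b : 0 < t -> a + b < to_nat (t, to_nat (a, b)).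
Proof.
  intros H; pose proof (to_nat_le a b); pose proof (to_nat_le t (to_nat (a, b))); lia.
Qed.

Lemma of_nat_bound n t m a b :
  of_nat n = (t, m) -> of_nat m = (a, b) -> 0 < t -> a < n /\ b < n.
Proof.
  intros E1 E2 Ht; rewrite <- (cancel_to_of n), E1, <- (cancel_to_of m), E2.
  pose proof (@to_nat_lt t a b Ht); lia.
Qed.

(** Only positive tags recurse, and there both components are smaller than [n]; fuel above [n] never
    runs out. *)
Lemma dec_fuel f : forall f' n, n < f -> n < f' -> dec f n = dec f' n.
Proof.
  induction f as [|f IH]; intros [|f'] n H H'; try lia; simpl.
  destruct (of_nat n) as [t m] eqn:E1; destruct (of_nat m) as [a b] eqn:E2.
  destruct t as [|t]; auto.
  destruct (of_nat_bound n E1 E2) as [Ha Hb]; [lia|].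
  rewrite (IH f' a), (IH f' b) by lia; reflexivity.
Qed.

Lemma decode_unfold t a b : decode (to_nat (t, to_nat (a, b))) =
  match t with
  | 0 => EqS a b
  | 1 => EqC a b
  | 2 => Mem a b
  | 3 => MemC a b
  | 5 => Imp (decode a) (decode b)
  | 6 => ForallS a (decode b)
  | 7 => ForallC a (decode b)
  | _ => Bot
  end.
Proof.
  unfold decode at 1; set (n := to_nat (t, to_nat (a, b))); simpl.
  assert (E1 : of_nat n = (t, to_nat (a, b))) by apply cancel_of_to.
  rewrite E1, cancel_of_to; destruct t as [|t]; auto.
  destruct (of_nat_bound n E1 (cancel_of_to (a, b))) as [Ha Hb]; [lia|].
  unfold decode; rewrite (dec_fuel (f' := S a)), (@dec_fuel n (S b) b) by lia; reflexivity.
Qed.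

Lemma to_nat_cases n : exists t a b, n = to_nat (t, to_nat (a, b)).
Proof.
  destruct (of_nat n) as [t m] eqn:E1; destruct (of_nat m) as [a b] eqn:E2.
  exists t, a, b; rewrite <- E2, cancel_to_of, <- E1, cancel_to_of; reflexivity.
Qed.

Lemma decode_code p : decode (code p) = p.
Proof.
  induction p; cbn [code]; try (rewrite decode_unfold; congruence).
  exact (decode_unfold 4 0 0).
Qed.

(** Class variables occur only under positive tags, where a code exceeds its components. Hence [n]
    is itself a class variable fresh for [decode n]. *)
Lemma fvC_decode n : forall X, In X (fvC (decode n)) -> X < n.
Proof.
  induction n as [n IH] using lt_wf_ind; intros X.
  destruct (to_nat_cases n) as (t & a & b & ->); rewrite decode_unfold.
  destruct t as [|t]; [intros []|].
  pose proof (@to_nat_lt (S t) a b ltac:(lia)) as L.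
  assert (Ha := IH a ltac:(lia)); assert (Hb := IH b ltac:(lia)).
  destruct t as [|[|[|[|[|[|[|t]]]]]]]; simpl in *; try tauto.
  - intros [<- | [<- | []]]; lia.
  - intros [<- | []]; lia.
  - intros [H%Ha | H%Hb]%in_app_iff; lia.
  - intros H%Hb; lia.
  - intros [H%Hb _]%in_remove; lia.
Qed.

(** * Countable elementary submodels and their collapse *)

(** Lists of Skolem terms: [hcons i a b] puts the term with head [i] and arguments [a] in front of
    [b]. This replaces the nested type of terms over lists by a plain one. *)
Inductive hterm (I : Type) : Type := hnil | hcons (i : I) (a b : hterm I).
Arguments hnil {I}.

Section Hull.

Variables (U I : Type) (F : I -> list U -> U).

Fixpoint hval (t : hterm I) : list U :=
  match t with hnil => [] | hcons i a b => F i (hval a) :: hval b end.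

Definition hull (u : U) : Prop := exists i t, u = F i (hval t).

Lemma hull_closed i l : Forall hull l -> hull (F i l).
Proof.
  intros H; enough (E : exists t, hval t = l) by (destruct E as [t <-]; exists i, t; auto).
  induction H as [|u l (j & t & ->) _ [t' <-]].
  - exists hnil; reflexivity.
  - exists (hcons j t t'); reflexivity.
Qed.

Variable g : I -> nat.
Hypothesis g_inj : forall i j, g i = g j -> i = j.

Fixpoint hcode (t : hterm I) : nat :=
  match t with
  | hnil => 0
  | hcons i a b => S (to_nat (g i, to_nat (hcode a, hcode b)))
  end.

Lemma hcode_inj t : forall t', hcode t = hcode t' -> t = t'.
Proof.
  induction t as [|i a IHa b IHb]; intros [|j a' b']; simpl; try discriminate; auto.
  intros [= E%to_nat_inj]; injection E as E1 E2%to_nat_inj; injection E2 as E2 E3.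
  f_equal; auto.
Qed.

Lemma hull_countable (u0 : U) : exists h : nat -> U, forall u, hull u -> exists n, h n = u.
Proof.
  exists (fun n => epsilon (inhabits u0)
    (fun u => exists i t, u = F i (hval t) /\ n = hcode (hcons i t hnil))).
  intros u (i & t & E); exists (hcode (hcons i t hnil)).
  match goal with |- epsilon ?a ?P = _ => destruct (epsilon_spec a P) as (j & t' & E1 & E2) end.
  { exists u, i, t; auto. }
  apply hcode_inj in E2; congruence.
Qed.

End Hull.

(** The left summand indexes witness functions, the right one constants that are to lie in the
    hull. *)
Definition skolem_index : Type := (form * nat * nat) + nat.

Definition skolem_code (i : skolem_index) : nat :=
  match i with
  | inl (p, x, N) => to_nat (0, to_nat (code p, to_nat (x, N)))
  | inr k => to_nat (1, k)
  end.

Lemma skolem_code_inj i j : skolem_code i = skolem_code j -> i = j.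
Proof.
  destruct i as [[[p x] N]|k], j as [[[q y] K]|l]; simpl;
    intros E%to_nat_inj; injection E; try discriminate.
  - intros E2%to_nat_inj; injection E2 as E2 E3%to_nat_inj; injection E3 as -> ->.
    rewrite <- (decode_code p), E2, decode_code; reflexivity.
  - intros ->; reflexivity.
Qed.

Section LowenheimSkolem.

Variables (S : structure) (u0 : set_dom S * class_dom S) (base : nat -> set_dom S).

(* Sets are read off the first [N] entries of the argument list, classes off the
   following ones. *)
Definition skolem (i : skolem_index) (l : list (set_dom S * class_dom S)) :
    set_dom S * class_dom S :=
  match i with
  | inl (p, x, N) =>
      let s j := fst (nth j l u0) in
      let c j := snd (nth (N + j) l u0) in
      (epsilon (inhabits (fst u0)) (fun a => ~ sat S (upd s x a) c p),
       epsilon (inhabits (snd u0)) (fun A => ~ sat S s (upd c x A) p))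
  | inr k => (base k, snd u0)
  end.

Definition hullS (a : set_dom S) : Prop := exists u, hull skolem u /\ a = fst u.
Definition hullC (A : class_dom S) : Prop := exists u, hull skolem u /\ A = snd u.

Lemma hullS_base k : hullS (base k).
Proof. exists (skolem (inr k) []); split; auto; apply hull_closed; auto. Qed.

Lemma hullC_inhabited : exists A, hullC A.
Proof.
  exists (snd u0), (skolem (inr 0) []); split; auto; apply hull_closed; auto.
Qed.

(** Finitely many arguments suffice, as satisfaction depends only on the free variables. Each set or
    class is one half of a pair in the hull, and the other half is ignored. *)
Lemma hull_args s c p x : (forall j, hullS (s j)) -> (forall j, hullC (c j)) ->
  exists l N, Forall (hull skolem) l /\
   (forall j, In j (x :: fvS p) -> fst (nth j l u0) = s j) /\
   (forall j, In j (x :: fvC p) -> snd (nth (N + j) l u0) = c j).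
Proof.
  intros Hs Hc.
  set (s' j := epsilon (inhabits u0) (fun u => hull skolem u /\ s j = fst u)).
  set (c' j := epsilon (inhabits u0) (fun u => hull skolem u /\ c j = snd u)).
  assert (Es : forall j, hull skolem (s' j) /\ s j = fst (s' j)).
  { intros j; exact (epsilon_spec (inhabits u0) _ (Hs j)). }
  assert (Ec : forall j, hull skolem (c' j) /\ c j = snd (c' j)).
  { intros j; exact (epsilon_spec (inhabits u0) _ (Hc j)). }
  set (N := 1 + x + list_max (fvS p) + list_max (fvC p)).
  assert (HN : forall j, In j (x :: fvS p) \/ In j (x :: fvC p) -> j < N).
  { intros j [[<- | H%in_list_max] | [<- | H%in_list_max]]; unfold N; lia. }
  exists (map s' (seq 0 N) ++ map c' (seq 0 N)), N; repeat split.
  - rewrite Forall_app, !Forall_map, !Forall_forall; split; intros; [apply Es | apply Ec].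
  - intros j Hj; assert (L : j < N) by auto.
    rewrite app_nth1 by (rewrite length_map, length_seq; auto).
    rewrite (nth_indep _ u0 (s' 0)) by (rewrite length_map, length_seq; auto).
    rewrite map_nth, seq_nth by auto; symmetry; apply Es.
  - intros j Hj; assert (L : j < N) by auto.
    rewrite app_nth2; rewrite length_map, length_seq; [|lia].
    replace (N + j - N) with j by lia.
    rewrite (nth_indep _ u0 (c' 0)) by (rewrite length_map, length_seq; auto).
    rewrite map_nth, seq_nth by auto; symmetry; apply Ec.
Qed.

(** The Tarski-Vaught criterion for both sorts: the Skolem function picks a counterexample whenever
    there is one, and its value lies in the hull. *)
Lemma hull_witness s c p x : (forall j, hullS (s j)) -> (forall j, hullC (c j)) ->
  ((forall a, hullS a -> sat S (upd s x a) c p) -> forall a, sat S (upd s x a) c p) /\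
  ((forall A, hullC A -> sat S s (upd c x A) p) -> forall A, sat S s (upd c x A) p).
Proof.
  intros Hs Hc; destruct (@hull_args s c p x) as (l & N & Hl & El1 & El2); auto.
  pose proof (@hull_closed _ _ skolem (inl (p, x, N)) l Hl) as Hw.
  set (s1 j := fst (nth j l u0)); set (c1 j := snd (nth (N + j) l u0)).
  assert (E1 : forall a, sat S (upd s1 x a) c1 p <-> sat S (upd s x a) c p).
  { intros a; apply sat_agree.
    - intros z Hz; unfold upd; destruct (Nat.eqb_spec x z); auto.
      apply El1; right; auto.
    - intros z Hz; apply El2; right; auto. }
  assert (E2 : forall A, sat S s1 (upd c1 x A) p <-> sat S s (upd c x A) p).
  { intros a; apply sat_agree.
    - intros z Hz; apply El1; right; auto.
    - intros z Hz; unfold upd; destruct (Nat.eqb_spec x z); auto.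
      apply El2; right; auto. }
  split; intros H a; apply NNPP; intros Ha.
  - refine (epsilon_spec (inhabits (fst u0)) (fun a => ~ sat S (upd s1 x a) c1 p) _ _).
    { exists a; rewrite E1; auto. }
    rewrite E1; apply H; exists (skolem (inl (p, x, N)) l); auto.
  - refine (epsilon_spec (inhabits (snd u0)) (fun A => ~ sat S s1 (upd c1 x A) p) _ _).
    { exists a; rewrite E2; auto. }
    rewrite E2; apply H; exists (skolem (inl (p, x, N)) l); auto.
Qed.

End LowenheimSkolem.

Section Collapse.

Variable H : V -> Prop.

(** The Mostowski collapse by recursion on trees: elements outside [H] are skipped at every
    level. *)
Fixpoint tcollapse (t : tree) : tree :=
  match t with
  | @sup A f => sup (fun a : {a : A | H (cls (f a))} => tcollapse (f (proj1_sig a)))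
  end.

Lemma tcollapse_teq x : forall y, teq x y -> teq (tcollapse x) (tcollapse y).
Proof.
  induction x as [A f IH]; intros [B g] [H1 H2]; simpl; split.
  - intros [a Ha]; destruct (H1 a) as [b Hb]; simpl.
    assert (Hg : H (cls (g b))) by (rewrite (proj2 (cls_eq _ _) Hb) in Ha; exact Ha).
    exists (exist _ b Hg); simpl; auto.
  - intros [b Hb]; destruct (H2 b) as [a Ha]; simpl.
    assert (Hf : H (cls (f a))) by (rewrite (proj2 (cls_eq _ _) Ha); exact Hb).
    exists (exist _ a Hf); simpl; auto.
Qed.

Definition collapse (x : V) : V := cls (tcollapse (rep x)).

Lemma mem_collapse z x : z ∈ collapse x <-> exists y, y ∈ x /\ H y /\ z = collapse y.
Proof.
  assert (E : forall t, collapse (cls t) = cls (tcollapse t)).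
  { intros t; apply cls_eq, tcollapse_teq, cls_eq, repK. }
  destruct (rep_exists x) as [[A f] ->]; rewrite E; simpl; rewrite mem_cls; split.
  - intros [[a Ha] ->]; exists (cls (f a)); rewrite E, mem_cls; eauto.
  - intros (y & [a ->]%mem_cls & Hy & ->); exists (exist _ a Hy); rewrite E; reflexivity.
Qed.

End Collapse.

Definition countable_set (x : V) : Prop :=
  exists f : nat -> V, forall y, y ∈ x -> exists n, y = f n.

(** Besides [r], all numerals are made constants of the hull, so that the collapse skips no element
    of [r] and leaves [r] unchanged. *)
Theorem countable_transitive_model T M X r :
  transitive_model T M X -> r ∈ M -> r ⊆ omega -> omega ⊆ M ->
  exists N Y, transitive_model T N Y /\ r ∈ N /\ countable_set N /\ countable_set Y.
Proof.
  intros (Mtr & XM & [a0] & [A0] & HT) rM rom omM.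
  set (S := standard_structure M X) in *.
  assert (base : exists b : nat -> set_dom S, proj1_sig (b 0) = r /\
    forall n, proj1_sig (b (Datatypes.S n)) = num n).
  { assert (Hn : forall n, num n ∈ M) by (intros n; apply omM, mem_omega; eauto).
    exists (fun n => match n with
      | 0 => exist _ r rM | Datatypes.S n => exist _ (num n) (Hn n) end); auto. }
  destruct base as (base & b0 & bS).
  set (u0 := (a0, A0) : set_dom S * class_dom S).
  set (HS := @hullS S u0 base); set (HC := @hullC S u0 base).
  set (H x := exists a, HS a /\ proj1_sig a = x).
  set (col := collapse H).
  destruct (hull_countable (skolem S u0 base) skolem_code skolem_code_inj u0) as [h Hh].
  assert (HSh : forall a, HS a -> exists n, a = fst (h n)).
  { intros a (u & Hu & ->); destruct (Hh u Hu) as [n <-]; eauto. }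
  assert (HCh : forall A, HC A -> exists n, A = snd (h n)).
  { intros a (u & Hu & ->); destruct (Hh u Hu) as [n <-]; eauto. }
  pose (N := cls (sup (fun n : {n | HS (fst (h n))} =>
    rep (col (proj1_sig (fst (h (proj1_sig n)))))))).
  pose (Y := cls (sup (fun n : {n | HC (snd (h n))} =>
    rep (col (proj1_sig (snd (h (proj1_sig n)))))))).
  assert (mN : forall z, z ∈ N <-> exists a, HS a /\ z = col (proj1_sig a)).
  { intros z; unfold N; rewrite mem_cls; split.
    - intros [[n Hn] ->]; rewrite repK; simpl; eauto.
    - intros (a & Ha & ->); destruct (HSh a Ha) as [n ->].
      exists (exist _ n Ha); rewrite repK; reflexivity. }
  assert (mY : forall z, z ∈ Y <-> exists A, HC A /\ z = col (proj1_sig A)).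
  { intros z; unfold Y; rewrite mem_cls; split.
    - intros [[n Hn] ->]; rewrite repK; simpl; eauto.
    - intros (a & Ha & ->); destruct (HCh a Ha) as [n ->].
      exists (exist _ n Ha); rewrite repK; reflexivity. }
  destruct (hullC_inhabited S u0 base) as [A1 HA1].
  (* By elementarity, distinct sets of the hull already differ on an element of the hull;
     extensionality is what makes the collapse injective. *)
  assert (extS : forall a b, HS a -> HS b ->
    (forall z, HS z -> mem_set S z a <-> mem_set S z b) -> a = b).
  { intros a b Ha Hb Hab; apply sig_eq, set_ext; intros z.
    destruct (@hull_witness S u0 base (fun j => if j =? 1 then a else b) (fun _ => A1)
      (Iff (Mem 0 1) (Mem 0 2)) 0) as [W _]; auto.
    { intros [|[|j]]; auto. }
    assert (W' : forall z, mem_set S z a <-> mem_set S z b).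
    { intros w; specialize (fun P => W P w); rewrite sat_Iff in W; apply W.
      intros v Hv; rewrite sat_Iff; exact (Hab v Hv). }
    split; intros Hz.
    - assert (zM : z ∈ M) by exact (Mtr _ (proj2_sig a) z Hz).
      exact (proj1 (W' (exist _ z zM)) Hz).
    - assert (zM : z ∈ M) by exact (Mtr _ (proj2_sig b) z Hz).
      exact (proj2 (W' (exist _ z zM)) Hz). }
  assert (extC : forall A B, HC A -> HC B ->
    (forall z, HS z -> mem_class S z A <-> mem_class S z B) -> A = B).
  { intros a b Ha Hb Hab; apply sig_eq, set_ext; intros z.
    destruct (@hull_witness S u0 base (fun j => base 0) (fun j => if j =? 1 then a else b)
      (Iff (MemC 0 1) (MemC 0 2)) 0) as [W _]; auto.
    { intros _; apply hullS_base. }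
    { intros [|[|j]]; auto. }
    assert (W' : forall z, mem_class S z a <-> mem_class S z b).
    { intros w; specialize (fun P => W P w); rewrite sat_Iff in W; apply W.
      intros v Hv; rewrite sat_Iff; exact (Hab v Hv). }
    split; intros Hz.
    - assert (zM : z ∈ M) by exact (XM _ (proj2_sig a) z Hz).
      exact (proj1 (W' (exist _ z zM)) Hz).
    - assert (zM : z ∈ M) by exact (XM _ (proj2_sig b) z Hz).
      exact (proj2 (W' (exist _ z zM)) Hz). }
  assert (colS : forall x a, proj1_sig a = x -> HS a -> forall b, HS b ->
    col (proj1_sig a) = col (proj1_sig b) -> a = b).
  { intros x; induction x as [x IH] using mem_induction; intros a <- Ha b Hb E.
    apply extS; auto; intros z Hz; split; intros Hza.
    - assert (Hc : col (proj1_sig z) ∈ col (proj1_sig b)).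
      { rewrite <- E; apply mem_collapse; exists (proj1_sig z); repeat split; auto.
        exists z; auto. }
      apply mem_collapse in Hc as (w & Hw & (w' & Hw' & <-) & Ew).
      rewrite (IH (proj1_sig z) Hza z eq_refl Hz w' Hw' Ew); exact Hw.
    - assert (Hc : col (proj1_sig z) ∈ col (proj1_sig a)).
      { rewrite E; apply mem_collapse; exists (proj1_sig z); repeat split; auto.
        exists z; auto. }
      apply mem_collapse in Hc as (w & Hw & (w' & Hw' & <-) & Ew).
      rewrite <- (IH (proj1_sig w') Hw w' eq_refl Hw' z Hz (eq_sym Ew)); exact Hw. }
  assert (memcol : forall z x, HS z ->
    (col (proj1_sig z) ∈ col x <-> proj1_sig z ∈ x)).
  { intros z x Hz; unfold col at 2; rewrite mem_collapse; split.
    - intros (w & Hw & (w' & Hw' & <-) & Ew).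
      rewrite (colS _ z eq_refl Hz w' Hw' Ew); exact Hw.
    - intros Hx; exists (proj1_sig z); repeat split; auto; exists z; auto. }
  assert (colC : forall A B, HC A -> HC B ->
    col (proj1_sig A) = col (proj1_sig B) -> A = B).
  { intros A B HA HB E; apply extC; auto; intros z Hz.
    simpl; rewrite <- !memcol, E by auto; tauto. }
  set (S' := standard_structure N Y).
  (* Isomorphism of hull and collapse and elementarity of the hull in one induction: at a
     quantifier, the collapsed domain gives only hull elements, and [hull_witness] passes to all
     elements. *)
  assert (EL : forall p (s : nat -> set_dom S) (c : nat -> class_dom S)
    (s' : nat -> set_dom S') (c' : nat -> class_dom S'),
    (forall j, HS (s j) /\ proj1_sig (s' j) = col (proj1_sig (s j))) ->
    (forall j, HC (c j) /\ proj1_sig (c' j) = col (proj1_sig (c j))) ->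
    sat S s c p <-> sat S' s' c' p).
  { intros p; induction p as [x y|x y|x y|x y| |p IHp q IHq|x p IHp|x p IHp];
      intros s c s' c' Es Ec; simpl.
    - destruct (Es x) as [Hx Ex], (Es y) as [Hy Ey]; split; intros E.
      + apply sig_eq; congruence.
      + apply (colS _ _ eq_refl); congruence.
    - destruct (Ec x) as [Hx Ex], (Ec y) as [Hy Ey]; split; intros E.
      + apply sig_eq; congruence.
      + apply colC; congruence.
    - destruct (Es x) as [Hx ->], (Es y) as [Hy ->]; rewrite memcol; tauto.
    - destruct (Es x) as [Hx ->], (Ec y) as [Hy ->]; rewrite memcol; tauto.
    - tauto.
    - rewrite (IHp s c s' c'), (IHq s c s' c') by auto; tauto.
    - split; intros Hp.
      + intros [a Ha]; destruct (proj1 (mN a) Ha) as (b & Hb & Eb).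
        apply (IHp (upd s x b) c); auto.
        intros j; unfold upd; destruct (x =? j); auto.
      + apply (hull_witness (u0 := u0) (base := base)); try (intros; apply Es || apply Ec).
        intros b Hb; assert (Ha : col (proj1_sig b) ∈ N) by (apply mN; eauto).
        apply (IHp _ _ (upd s' x (exist (fun z => z ∈ N) _ Ha)) c'); auto.
        intros j; unfold upd; destruct (x =? j); auto.
    - split; intros Hp.
      + intros [a Ha]; destruct (proj1 (mY a) Ha) as (b & Hb & Eb).
        apply (IHp s (upd c x b)); auto.
        intros j; unfold upd; destruct (x =? j); auto.
      + apply (hull_witness (u0 := u0) (base := base)); try (intros; apply Es || apply Ec).
        intros b Hb; assert (Ha : col (proj1_sig b) ∈ Y) by (apply mY; eauto).
        apply (IHp _ _ s' (upd c' x (exist (fun z => z ∈ Y) _ Ha))); auto.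
        intros j; unfold upd; destruct (x =? j); auto. }
  (* All elements of a numeral are numerals, hence in the hull, so nothing is skipped. *)
  assert (colnum : forall n, col (num n) = num n).
  { intros n; induction n as [n IH] using lt_wf_ind; apply set_ext; intros z.
    unfold col; rewrite mem_collapse, mem_num; split.
    - intros (y & (m & Hm & ->)%mem_num & _ & ->); exists m; split; auto; apply IH; auto.
    - intros (m & Hm & ->); exists (num m); repeat split.
      + apply mem_num; eauto.
      + exists (base (Datatypes.S m)); split; auto; apply hullS_base.
      + symmetry; apply IH; auto. }
  assert (rN : r ∈ N).
  { apply mN; exists (base 0); split; [apply hullS_base|]; rewrite b0.
    apply set_ext; intros z; unfold col; rewrite mem_collapse; split.
    - intros Hz; destruct (proj1 (mem_omega z) (rom z Hz)) as [n ->].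
      exists (num n); repeat split; auto.
      exists (base (Datatypes.S n)); split; auto; apply hullS_base.
    - intros (y & Hy & _ & ->); destruct (proj1 (mem_omega y) (rom y Hy)) as [n ->].
      change (col (num n) ∈ r); rewrite colnum; exact Hy. }
  exists N, Y; split; [split; [|split; [|split; [|split]]] | split; [|split]]; auto.
  - intros y (a & Ha & ->)%mN z (w & _ & (b & Hb & <-) & ->)%mem_collapse.
    apply mN; eauto.
  - intros A (B & HB & ->)%mY z (w & _ & (b & Hb & <-) & ->)%mem_collapse.
    apply mN; eauto.
  - constructor; exists r; exact rN.
  - constructor; exists (col (proj1_sig A1)); apply mY; eauto.
  - intros p Hp s' c'.
    assert (Cs : forall j, exists a, HS a /\ proj1_sig (s' j) = col (proj1_sig a)).
    { intros j; apply mN, (proj2_sig (s' j)). }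
    assert (Cc : forall j, exists a, HC a /\ proj1_sig (c' j) = col (proj1_sig a)).
    { intros j; apply mY, (proj2_sig (c' j)). }
    apply (EL p _ _ s' c'
      (fun j => epsilon_spec (inhabits a0) _ (Cs j))
      (fun j => epsilon_spec (inhabits A0) _ (Cc j))).
    apply HT; exact Hp.
  - exists (fun n => col (proj1_sig (fst (h n)))).
    intros y (a & Ha & ->)%mN; destruct (HSh a Ha) as [n ->]; eauto.
  - exists (fun n => col (proj1_sig (snd (h n)))).
    intros y (a & Ha & ->)%mY; destruct (HCh a Ha) as [n ->]; eauto.
Qed.

(** * Definability over a model of [GB + Π¹₁-CA] *)

Definition pt (x : V) : Type := {y : V | y ∈ x}.

Definition Pi11_model (M X : V) : Prop :=
  transitive_set M /\ (forall A, A ∈ X -> A ⊆ M) /\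
  models (standard_structure M X) GB_Pi11_CA.

Section Definability.

Variables M X : V.
Hypothesis model : Pi11_model M X.

Notation Ms := (pt M).
Notation Cs := (pt X).
Notation St := (standard_structure M X).

Definition ms (N : V) (x y : pt N) : Prop := proj1_sig x ∈ proj1_sig y.
Definition mc (N Y : V) (x : pt N) (A : pt Y) : Prop := proj1_sig x ∈ proj1_sig A.

(** Variables are numbered from the outside in: a new quantifier binds variable [k], the last
    component, and earlier variables keep their numbers. *)
Fixpoint env (k : nat) : Type := match k with 0 => unit | S k => (env k * Ms)%type end.

Fixpoint tup (k : nat) (s : nat -> Ms) : env k :=
  match k with 0 => tt | S k => (tup k s, s k) end.

Definition ccons (Z : Cs) (c : nat -> Cs) : nat -> Cs :=
  fun i => match i with 0 => Z | S i => c i end.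

Definition definable (P : Cs -> (nat -> Ms) -> Prop) : Prop :=
  exists p c, elementary p /\ forall Z s, sat St s (ccons Z c) p <-> P Z s.

(* The class argument is a variable for the class quantifier of a Π¹₁ formula. *)
Definition D (k : nat) (P : Cs -> env k -> Prop) : Prop :=
  definable (fun Z s => P Z (tup k s)).

Lemma tup_agree k s s' : (forall i, i < k -> s i = s' i) -> tup k s = tup k s'.
Proof.
  induction k as [|k IH]; simpl; intros H; [reflexivity|].
  rewrite IH, H by auto; reflexivity.
Qed.

Lemma tup_upd k s a : tup k (upd s k a) = tup k s.
Proof. apply tup_agree; intros i Hi; apply upd_neq; lia. Qed.

Lemma definable_iff (P Q : Cs -> (nat -> Ms) -> Prop) :
  (forall Z s, P Z s <-> Q Z s) -> definable P -> definable Q.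
Proof.
  intros H (p & c & Hp & E); exists p, c; split; auto; intros; rewrite E; apply H.
Qed.

Lemma D_iff k (P Q : Cs -> env k -> Prop) :
  (forall Z s, P Z s <-> Q Z s) -> D k P -> D k Q.
Proof. intros H; apply definable_iff; auto. Qed.

(** Merges the parameters of two formulas: even positions serve the first, odd ones the second, and
    variable 0 remains the class argument. *)
Let twice (b i : nat) : nat := match i with 0 => 0 | S i => S (2 * i + b) end.

Lemma D_imp k (P Q : Cs -> env k -> Prop) :
  D k P -> D k Q -> D k (fun Z s => P Z s -> Q Z s).
Proof.
  intros (p & c & Hp & E) (q & c' & Hq & E').
  exists (Imp (rename_class (twice 0) p) (rename_class (twice 1) q)).
  exists (fun i => if Nat.even i then c (Nat.div2 i) else c' (Nat.div2 i)).
  split; [split; auto using elementary_rename_class|].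
  intros Z s; simpl; rewrite !sat_rename_class by auto.
  rewrite <- E, <- E'.
  match goal with |- (sat _ _ ?c1 _ -> sat _ _ ?c2 _) <-> _ =>
    replace c1 with (ccons Z c); [replace c2 with (ccons Z c'); [tauto|]|] end;
    extensionality i; destruct i as [|i]; auto; cbn [ccons twice].
  - rewrite Nat.even_odd, Nat.div2_odd'; reflexivity.
  - rewrite Nat.add_0_r, Nat.even_even, Nat.div2_even; reflexivity.
Qed.

Lemma D_False k : D k (fun Z s => False).
Proof.
  destruct model as (_ & _ & _ & [A] & _).
  exists Bot, (fun _ => A); split; simpl; tauto.
Qed.

Lemma D_not k P : D k P -> D k (fun Z s => ~ P Z s).
Proof. intros H; apply D_imp; auto using D_False. Qed.

Lemma D_or k P Q : D k P -> D k Q -> D k (fun Z s => P Z s \/ Q Z s).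
Proof.
  intros HP HQ; apply D_iff with (fun Z s => ~ P Z s -> Q Z s).
  - intros; tauto.
  - auto using D_imp, D_not.
Qed.

Lemma D_and k P Q : D k P -> D k Q -> D k (fun Z s => P Z s /\ Q Z s).
Proof.
  intros HP HQ; apply D_iff with (fun Z s => ~ (P Z s -> ~ Q Z s)).
  - intros; tauto.
  - auto using D_imp, D_not.
Qed.

Lemma D_equiv k P Q : D k P -> D k Q -> D k (fun Z s => P Z s <-> Q Z s).
Proof. intros HP HQ; apply D_and; auto using D_imp. Qed.

Lemma D_all k (Q : Cs -> env k -> Ms -> Prop) :
  D (S k) (fun Z s => Q Z (fst s) (snd s)) -> D k (fun Z s => forall a, Q Z s a).
Proof.
  intros (p & c & Hp & E); exists (ForallS k p), c; split; auto.
  intros Z s; simpl; split; intros H a; specialize (H a).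
  - apply E in H; simpl in H; rewrite tup_upd, upd_eq in H; exact H.
  - apply E; simpl; rewrite tup_upd, upd_eq; exact H.
Qed.

Lemma D_ex k (Q : Cs -> env k -> Ms -> Prop) :
  D (S k) (fun Z s => Q Z (fst s) (snd s)) -> D k (fun Z s => exists a, Q Z s a).
Proof.
  intros H; apply D_iff with (fun Z s => ~ forall a, ~ Q Z s a).
  - intros Z s; split.
    + apply not_all_not_ex.
    + intros [a Ha] H'; exact (H' a Ha).
  - apply D_not, D_all, D_not, H.
Qed.

(** Weakening just below the last variable: all variables from [k] on, bound ones included, move up
    by one. *)
Lemma D_shift k (Q : Cs -> env k -> Ms -> Prop) :
  D (S k) (fun Z s => Q Z (fst s) (snd s)) ->
  D (S (S k)) (fun Z s => Q Z (fst (fst s)) (snd s)).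
Proof.
  set (f i := if i <? k then i else S i).
  assert (Hf : forall i j, f i = f j -> i = j).
  { intros i j; unfold f; destruct (Nat.ltb_spec i k), (Nat.ltb_spec j k); lia. }
  intros (p & c & Hp & E); exists (rename_set f p), c.
  split; [apply elementary_rename_set; auto|].
  intros Z s; rewrite sat_rename_set, E by auto; simpl.
  rewrite (@tup_agree k (fun x => s (f x)) s).
  - unfold f; rewrite Nat.ltb_irrefl; tauto.
  - intros i Hi; unfold f; apply Nat.ltb_lt in Hi; rewrite Hi; auto.
Qed.

(** The language has no function symbols, so a term is a function with definable graph; substituting
    it costs one set quantifier. *)
Definition Tm (k : nat) (t : env k -> Ms) : Prop := D (S k) (fun Z s => snd s = t (fst s)).

Lemma D_subst k (R : Cs -> env k -> Ms -> Prop) t : Tm k t ->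
  D (S k) (fun Z s => R Z (fst s) (snd s)) -> D k (fun Z s => R Z s (t s)).
Proof.
  intros Ht HR; apply D_iff with (fun Z s => exists a, a = t s /\ R Z s a).
  - intros Z s; split; [intros (a & -> & H); auto | eauto].
  - apply D_ex, D_and; auto.
Qed.

Lemma Tm_wk k t : Tm k t -> Tm (S k) (fun s => t (fst s)).
Proof. apply (@D_shift k (fun Z s a => a = t s)). Qed.

Let some_class : inhabited Cs.
Proof. apply model. Qed.

Lemma Tm_snd k : Tm (S k) (fun s => snd s).
Proof.
  destruct some_class as [A]; exists (EqS (S k) k), (fun _ => A); simpl; tauto.
Qed.

Lemma D_eq k t u : Tm k t -> Tm k u -> D k (fun Z s => t s = u s).
Proof.
  intros Ht Hu; apply (D_subst (fun Z s a => a = u s) Ht); exact Hu.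
Qed.

Lemma D_ms k t u : Tm k t -> Tm k u -> D k (fun Z s => ms (t s) (u s)).
Proof.
  intros Ht Hu; apply (D_subst (fun Z s a => ms a (u s)) Ht).
  apply (@D_subst (S k) (fun Z s a => ms (snd s) a) _ (Tm_wk Hu)).
  destruct some_class as [A]; exists (Mem k (S k)), (fun _ => A); simpl; unfold ms; tauto.
Qed.

Lemma D_mc k t (A : Cs) : Tm k t -> D k (fun Z s => mc (t s) A).
Proof.
  intros Ht; apply (D_subst (fun Z s a => mc a A) Ht).
  exists (MemC k 1), (fun _ => A); simpl; unfold mc; tauto.
Qed.

Lemma D_class k t : Tm k t -> D k (fun Z s => mc (t s) Z).
Proof.
  intros Ht; apply (D_subst (fun Z s a => mc a Z) Ht).
  destruct some_class as [A]; exists (MemC k 0), (fun _ => A); simpl; unfold mc; tauto.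
Qed.

Lemma ms_ext (x y : Ms) : (forall z, ms z x <-> ms z y) -> x = y.
Proof.
  destruct model as (Mtr & _); intros H; apply sig_eq, set_ext; intros z; split; intros Hz.
  - exact (proj1 (H (exist _ z (Mtr _ (proj2_sig x) z Hz))) Hz).
  - exact (proj2 (H (exist _ z (Mtr _ (proj2_sig y) z Hz))) Hz).
Qed.

(** By extensionality, a definition of the elements of [t s] defines its graph. *)
Lemma Tm_set k t (Q : Cs -> env k -> Ms -> Prop) :
  (forall Z s z, ms z (t s) <-> Q Z s z) ->
  D (S k) (fun Z s => Q Z (fst s) (snd s)) -> Tm k t.
Proof.
  intros H HQ; apply D_iff with (fun Z s => forall z, ms z (snd s) <-> Q Z (fst s) z).
  - intros Z [s a]; simpl; split.
    + intros E; apply ms_ext; intros z; rewrite E, (H Z); tauto.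
    + intros ->; apply H.
  - apply D_all, D_equiv.
    + apply D_ms; auto using Tm_snd, Tm_wk.
    + apply D_shift, HQ.
Qed.

Lemma axiom_holds p : GB_Pi11_CA p -> holds St p.
Proof. apply model. Qed.

Lemma Pi11_comprehension (Q : Cs -> (nat -> Ms) -> Prop) (s : nat -> Ms) :
  definable Q -> exists A : Cs, forall x, mc x A <-> forall Z, Q Z (upd s 0 x).
Proof.
  intros (p & c & Hp & E); destruct some_class as [A0].
  pose (W := S (list_max (fvC p))).
  assert (HW : ~ In W (fvC p)).
  { intros H%in_list_max; unfold W in H; lia. }
  assert (C : comprehension Pi11
    (close (ExistsC W (ForallS 0 (Iff (MemC 0 W) (ForallC 0 p)))))).
  { constructor; [constructor; auto|]; simpl.
    intros [H _]%in_remove; auto. }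
  assert (Hh := axiom_holds (or_intror C)).
  rewrite holds_close in Hh; specialize (Hh s (ccons A0 c)).
  apply sat_ExistsC in Hh as [A HA]; exists A; intros x.
  specialize (HA x); apply sat_Iff in HA; simpl in HA; rewrite !upd_eq in HA.
  unfold mc; rewrite HA; split; intros H Z; specialize (H Z).
  - rewrite <- E; revert H; apply sat_agree; auto.
    intros V' HV; unfold W in *; destruct V' as [|v]; [reflexivity|].
    rewrite upd_neq, upd_neq by congruence; reflexivity.
  - rewrite <- E in H; revert H; apply sat_agree; auto.
    intros V' HV; unfold W in *; destruct V' as [|v]; [reflexivity|].
    rewrite upd_neq, upd_neq by congruence; reflexivity.
Qed.

Lemma D_Pi11_comprehension (Q : Cs -> Ms -> Prop) :
  D 1 (fun Z s => Q Z (snd s)) -> exists A : Cs, forall x, mc x A <-> forall Z, Q Z x.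
Proof.
  intros H; destruct model as (_ & _ & [a] & _).
  destruct (Pi11_comprehension (fun _ => a) H) as [A HA].
  exists A; intros x; rewrite HA; simpl; rewrite upd_eq; tauto.
Qed.

Definition isclass (P : Ms -> Prop) : Prop := exists A : Cs, forall x, mc x A <-> P x.

(** Elementary comprehension as Π¹₁ comprehension with a dummy class quantifier. *)
Lemma comprehension_class (P : Ms -> Prop) : D 1 (fun Z s => P (snd s)) -> isclass P.
Proof.
  intros H; destruct (D_Pi11_comprehension (fun Z x => P x) H) as [A HA].
  exists A; intros x; rewrite HA; destruct some_class; tauto.
Qed.

Lemma D_isclass P k t : isclass P -> Tm k t -> D k (fun Z s => P (t s)).
Proof.
  intros [A HA] Ht; apply D_iff with (fun Z s => mc (t s) A).
  - intros; apply HA.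
  - apply D_mc, Ht.
Qed.

(** [D] admits only class parameters. A set parameter is traded for the class of its elements, which
    comprehension with a set parameter supplies. *)
Lemma Tm_const k a : Tm k (fun _ => a).
Proof.
  assert (C : isclass (fun x => ms x a)).
  { destruct some_class as [A0].
    destruct (@Pi11_comprehension (fun Z s => ms (s 0) (s 1)) (fun _ => a)) as [A HA].
    - exists (Mem 0 1), (fun _ => A0); simpl; unfold ms; tauto.
    - exists A; intros x; rewrite HA; rewrite upd_eq, upd_neq by auto.
      split; intros; auto. }
  apply Tm_set with (fun Z s z => ms z a); [tauto|].
  apply (D_isclass C), Tm_snd.
Qed.

(** ** Sets of the model *)

Lemma upair_exists (x y : Ms) : exists z : Ms, forall w, ms w z <-> w = x \/ w = y.
Proof.
  assert (H : holds St ax_pairing) by (apply axiom_holds; left; do 2 constructor).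
  destruct some_class as [A]; specialize (H (fun _ => x) (fun _ => A) x y).
  apply sat_ExistsS in H as [z H]; exists z; intros w; specialize (H w).
  rewrite sat_Iff, sat_Or in H; exact H.
Qed.

Lemma union_exists (x : Ms) : exists z : Ms, forall w, ms w z <-> exists y, ms w y /\ ms y x.
Proof.
  assert (H : holds St ax_union) by (apply axiom_holds; left; do 2 constructor).
  destruct some_class as [A]; specialize (H (fun _ => x) (fun _ => A) x).
  apply sat_ExistsS in H as [z H]; exists z; intros w; specialize (H w).
  rewrite sat_Iff, sat_ExistsS in H.
  assert (E : (exists y, ms w y /\ ms y x) <->
    exists a, sat St (upd (upd (upd (upd (fun _ => x) 0 x) 1 z) 2 w) 3 a) (fun _ => A)
      (And (Mem 2 3) (Mem 3 0))).
  { split; intros [y Hy]; exists y; [rewrite sat_And; exact Hy|].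
    rewrite sat_And in Hy; exact Hy. }
  rewrite E; exact H.
Qed.

Definition upair (x y : Ms) : Ms :=
  proj1_sig (constructive_indefinite_description _ (upair_exists x y)).

Lemma ms_upair x y w : ms w (upair x y) <-> w = x \/ w = y.
Proof. unfold upair; destruct constructive_indefinite_description; auto. Qed.

Lemma adj_exists (x y : Ms) : exists z : Ms, forall w, ms w z <-> ms w x \/ w = y.
Proof.
  destruct (union_exists (upair x (upair y y))) as [z Hz]; exists z; intros w.
  rewrite Hz; split.
  - intros (v & Hv & [-> | ->]%ms_upair); auto.
    apply ms_upair in Hv; tauto.
  - intros [H | ->]; [exists x | exists (upair y y)]; rewrite !ms_upair; auto.
Qed.

(* x ∪ {y} *)
Definition adj (x y : Ms) : Ms :=
  proj1_sig (constructive_indefinite_description _ (adj_exists x y)).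

Lemma ms_adj x y w : ms w (adj x y) <-> ms w x \/ w = y.
Proof. unfold adj; destruct constructive_indefinite_description; auto. Qed.

Definition pr (x y : Ms) : Ms := upair (upair x x) (upair x y).

Lemma ms_pr x y w : ms w (pr x y) <-> w = upair x x \/ w = upair x y.
Proof. apply ms_upair. Qed.

Lemma pr_inj x y x' y' : pr x y = pr x' y' -> x = x' /\ y = y'.
Proof.
  assert (U : forall a b c d : Ms, upair a b = upair c d ->
    (a = c /\ b = d) \/ (a = d /\ b = c)).
  { intros a b c d E.
    assert (H : forall w, (w = a \/ w = b) <-> (w = c \/ w = d))
      by (intros w; rewrite <- !ms_upair, E; tauto).
    pose proof (proj1 (H a) (or_introl eq_refl)); pose proof (proj1 (H b) (or_intror eq_refl)).
    pose proof (proj2 (H c) (or_introl eq_refl)); pose proof (proj2 (H d) (or_intror eq_refl)).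
    intuition congruence. }
  intros [[E1%U E2%U] | [E1%U E2%U]]%U; intuition congruence.
Qed.

Lemma Tm_upair k t u : Tm k t -> Tm k u -> Tm k (fun s => upair (t s) (u s)).
Proof.
  intros Ht Hu; apply Tm_set with (fun Z s z => z = t s \/ z = u s).
  - intros; apply ms_upair.
  - apply D_or; assumption.
Qed.

Lemma Tm_pr k t u : Tm k t -> Tm k u -> Tm k (fun s => pr (t s) (u s)).
Proof. intros Ht Hu; apply Tm_upair; apply Tm_upair; auto. Qed.

Lemma Tm_adj k t u : Tm k t -> Tm k u -> Tm k (fun s => adj (t s) (u s)).
Proof.
  intros Ht Hu; apply Tm_set with (fun Z s z => ms z (t s) \/ z = u s).
  - intros; apply ms_adj.
  - apply D_or; [|exact Hu]; apply D_ms; auto using Tm_snd, Tm_wk.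
Qed.

End Definability.

(** * Automatic proofs of definability *)

Ltac dhook := fail.

Ltac dauto :=
  cbv beta;
  first
  [ assumption
  | match goal with
    | |- @Tm _ _ _ (fun s => snd s) => apply Tm_snd
    | |- @Tm _ _ _ (@snd _ _) => apply Tm_snd
    | |- @Tm _ _ _ (fun s => pr _ _ _) => apply Tm_pr
    | |- @Tm _ _ _ (fun s => adj _ _ _) => apply Tm_adj
    | |- @Tm _ _ _ (fun s => ?a) => apply Tm_const
    (* A function that ignores the last variable is pulled back along [fst]; this is how earlier
       variables are reached. *)
    | |- @Tm ?M _ (S ?k) ?f =>
        let h := constr:(fun (d : pt M) (e : env M k) => f (e, d)) in
        let h := eval cbn [fst snd] in h in
        match h with fun _ => ?g => apply (@Tm_wk _ _ k g) end
    | |- @D _ _ _ (fun Z s => _ <-> _) => apply D_equiv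
    | |- @D _ _ _ (fun Z s => _ /\ _) => apply D_and
    | |- @D _ _ _ (fun Z s => _ \/ _) => apply D_or
    | |- @D _ _ _ (fun Z s => ~ _) => apply D_not
    | |- @D _ _ _ (fun Z s => exists a, _) => apply D_ex
    | |- @D _ _ _ (fun Z s => ms _ _) => apply D_ms
    | |- @D _ _ _ (fun Z s => mc _ Z) => apply D_class
    | |- @D _ _ _ (fun Z s => mc _ _) => apply D_mc
    | |- @D _ _ _ (fun Z s => _ = _) => apply D_eq
    | |- @D _ _ _ (fun Z s => False) => apply D_False
    | |- @D _ _ _ (fun Z s => _ -> _) => apply D_imp
    | |- @D _ _ _ (fun Z s => forall a, _) => apply D_all
    end; dauto
  | dhook; dauto
  | idtac ].

Ltac upd_simpl := repeat first [rewrite upd_eq in * | rewrite upd_neq in * by lia].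

(** * Replacement, separation and ω in the model *)

Section Replacement.

Variables M X : V.
Hypothesis model : Pi11_model M X.

Notation Ms := (pt M).
Notation Cs := (pt X).
Notation St := (standard_structure M X).
Notation pr := (pr model).
Notation adj := (adj model).
Notation D := (@D M X).
Notation Tm := (@Tm M X).
Notation isclass := (@isclass M X).

(** Quantifying over all terms builds closure under substitution into the notion. *)
Definition D2 (R : Ms -> Ms -> Prop) : Prop :=
  forall k t u, Tm k t -> Tm k u -> D k (fun Z s => R (t s) (u s)).

Lemma sat_is_pair (s : nat -> Ms) (c : nat -> Cs) p x y :
  p < 10 -> x < 10 -> y < 10 ->
  sat St s c (is_pair p x y) <-> s p = pr (s x) (s y).
Proof.
  intros Hp Hx Hy.
  assert (A1 : forall w, sat St (upd s 10 w) c (ForallS 11 (Iff (Mem 11 10) (EqS 11 x)))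
    <-> w = upair model (s x) (s x)).
  { intros w; transitivity (forall v : Ms, ms v w <-> v = s x).
    - split; intros H v; specialize (H v); [rewrite sat_Iff in H | rewrite sat_Iff];
        cbn [sat] in *; upd_simpl; exact H.
    - split.
      + intros H; apply (ms_ext model); intros z; rewrite H, ms_upair; tauto.
      + intros -> v; rewrite ms_upair; tauto. }
  assert (A2 : forall w, sat St (upd s 10 w) c
    (ForallS 11 (Iff (Mem 11 10) (Or (EqS 11 x) (EqS 11 y))))
    <-> w = upair model (s x) (s y)).
  { intros w; transitivity (forall v : Ms, ms v w <-> v = s x \/ v = s y).
    - split; intros H v; specialize (H v);
        [rewrite sat_Iff, sat_Or in H | rewrite sat_Iff, sat_Or];
        cbn [sat] in *; upd_simpl; exact H.
    - split.
      + intros H; apply (ms_ext model); intros z; rewrite H, ms_upair; tauto.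
      + intros -> v; rewrite ms_upair; tauto. }
  transitivity (forall w : Ms, ms w (s p) <-> ms w (pr (s x) (s y))).
  - split; intros H w; specialize (H w); [rewrite sat_Iff, sat_Or in H | rewrite sat_Iff, sat_Or];
      rewrite A1, A2 in *; cbn [sat] in *; upd_simpl;
      rewrite ms_pr in *; exact H.
  - split; [apply (ms_ext model) | intros ->; tauto].
Qed.

Lemma replacement (R : Ms -> Ms -> Prop) (a : Ms) : D2 R ->
  (forall x y z, R x y -> R x z -> y = z) ->
  exists b : Ms, forall y, ms y b <-> exists x, ms x a /\ R x y.
Proof.
  intros HR Hfun.
  destruct (@comprehension_class M X model (fun z => exists x y, R x y /\ z = pr x y))
    as [F HF].
  { dauto; apply HR; dauto. }
  assert (pin : forall (s : nat -> Ms) (c : nat -> Cs) x y, c 0 = F -> x < 9 -> y < 9 ->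
    sat St s c (pair_in x y 0) <-> R (s x) (s y)).
  { intros s c x y Hc Hx Hy; unfold pair_in; rewrite sat_ExistsS; split.
    - intros [w H]; rewrite sat_And, sat_is_pair in H by lia; destruct H as [H1 H2].
      cbn [sat] in H2; rewrite Hc, upd_eq in H2; rewrite upd_eq, !upd_neq in H1 by lia.
      apply HF in H2 as (u & v & H2 & H3); rewrite H1 in H3.
      apply pr_inj in H3 as [-> ->]; exact H2.
    - intros H; exists (pr (s x) (s y)); rewrite sat_And, sat_is_pair by lia.
      rewrite upd_eq, !upd_neq by lia; split; auto.
      cbn [sat]; rewrite Hc, upd_eq; apply HF; eauto. }
  assert (H : holds St ax_class_replacement).
  { apply (axiom_holds model); left; constructor 3. }
  specialize (H (fun _ => a) (fun _ => F) F).
  assert (CF : sat St (fun _ => a) (upd (fun _ => F) 0 F) (class_function 0)).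
  { unfold class_function; apply sat_And; split.
    - intros z Hz; apply sat_ExistsS.
      assert (Hz' : mc z F) by exact Hz; apply HF in Hz' as (x & y & _ & ->).
      exists x; apply sat_ExistsS; exists y; apply sat_is_pair; try lia; reflexivity.
    - intros x y z H2; apply sat_And in H2 as [H2 H3].
      apply pin in H2; try reflexivity; try lia; apply pin in H3; try reflexivity; try lia.
      exact (Hfun _ _ _ H2 H3). }
  specialize (H CF a); apply sat_ExistsS in H as [b Hb]; exists b; intros y.
  specialize (Hb y); rewrite sat_Iff, sat_ExistsS in Hb.
  transitivity (exists x, sat St
    (upd (upd (upd (upd (fun _ => a) 0 a) 1 b) 2 y) 3 x) (upd (fun _ => F) 0 F)
    (And (Mem 3 0) (pair_in 3 2 0))).
  - exact Hb.
  - split; intros [x Hx]; exists x; [rewrite sat_And, pin in Hx | rewrite sat_And, pin];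
      try reflexivity; try lia; exact Hx.
Qed.

(** Class Replacement for a restriction of the identity. Unlike the schema of ZF, this allows class
    parameters in [P]. *)
Lemma separation (P : Ms -> Prop) (a : Ms) :
  (forall k t, Tm k t -> D k (fun Z s => P (t s))) ->
  exists b : Ms, forall x, ms x b <-> ms x a /\ P x.
Proof.
  intros HP; destruct (@replacement (fun x y => x = y /\ P x) a) as [b Hb].
  - intros k t u Ht Hu; apply D_and; auto; apply D_eq; auto.
  - intros x y z [<- _] [<- _]; reflexivity.
  - exists b; intros x; rewrite Hb; split.
    + intros (y & Hy & -> & H); auto.
    + intros [H1 H2]; exists x; auto.
Qed.

Lemma ms_cases (x : Ms) z : z ∈ proj1_sig x -> exists w : Ms, proj1_sig w = z.
Proof.
  intros H; destruct model as (Mtr & _).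
  exists (exist _ z (Mtr _ (proj2_sig x) z H)); reflexivity.
Qed.

Lemma proj_adj x y z :
  z ∈ proj1_sig (adj x y) <-> z ∈ proj1_sig x \/ z = proj1_sig y.
Proof.
  split.
  - intros H; destruct (ms_cases _ H) as [w <-]; apply ms_adj in H as [H | ->]; auto.
  - intros [H | ->].
    + destruct (ms_cases _ H) as [w <-]; apply ms_adj; auto.
    + apply ms_adj; auto.
Qed.

Lemma num_mem n : num n ∈ M.
Proof.
  assert (H : holds St ax_infinity) by (apply (axiom_holds model); left; do 2 constructor).
  pose proof (proj1 (proj2 (proj2 model))) as [a]; pose proof (proj1 (proj2 (proj2 (proj2 model)))) as [A].
  specialize (H (fun _ => a) (fun _ => A)); apply sat_ExistsS in H as [w H].
  apply sat_And in H as [H _]; apply sat_ExistsS in H as [e H]; apply sat_And in H as [_ He].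
  assert (E : proj1_sig e = num 0).
  { apply set_ext; intros z; split; [|intros []%mem_num0].
    intros Hz; destruct (ms_cases _ Hz) as [v <-]; destruct (He v Hz). }
  induction n as [|n IH]; [rewrite <- E; apply proj2_sig|].
  assert (E' : proj1_sig (adj (exist _ (num n) IH) (exist _ (num n) IH)) = num (S n)).
  { apply set_ext; intros z; rewrite proj_adj, mem_numS; reflexivity. }
  rewrite <- E'; apply proj2_sig.
Qed.

Definition nm (n : nat) : Ms := exist _ (num n) (num_mem n).

Lemma nm_inj m n : nm m = nm n -> m = n.
Proof. intros E; apply num_inj; exact (f_equal (@proj1_sig _ _) E). Qed.

Lemma ms_nm0 x : ~ ms x (nm 0).
Proof. apply mem_num0. Qed.

Lemma nm_S n : nm (S n) = adj (nm n) (nm n).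
Proof. apply sig_eq, set_ext; intros z; rewrite proj_adj; apply mem_numS. Qed.

Lemma ms_nm x n : ms x (nm n) <-> exists m, m < n /\ x = nm m.
Proof.
  unfold ms; simpl; rewrite mem_num; split; intros (m & Hm & E); exists m; split; auto.
  - apply sig_eq; exact E.
  - rewrite E; reflexivity.
Qed.

(** An elementary description of the numerals. It works because membership is truly well-founded:
    passing from [x] to predecessors must end at 0 after finitely many steps. *)
Let natlike (x : Ms) : Prop := forall y, y = x \/ ms y x ->
  y = nm 0 \/ exists z, ms z x /\ y = adj z z.

Lemma natlike_nm x : natlike x -> exists n, x = nm n.
Proof.
  assert (G : forall v (x : Ms), proj1_sig x = v -> natlike x -> exists n, x = nm n).
  { intros v; induction v as [v IH] using mem_induction; intros y <- Hy.
    destruct (Hy y (or_introl eq_refl)) as [-> | (z & Hz & E)]; [eauto|].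
    enough (Nz : natlike z).
    { destruct (IH _ Hz z eq_refl Nz) as [n ->]; exists (S n); rewrite nm_S; exact E. }
    intros w Hw.
    assert (Hwy : ms w y) by (rewrite E, ms_adj; tauto).
    destruct (Hy w (or_intror Hwy)) as [H | (u & Hu & Eu)]; [tauto|].
    right; exists u; split; auto.
    rewrite E, ms_adj in Hu; destruct Hu as [Hu | ->]; auto.
    destruct Hw as [-> | Hw].
    - rewrite Eu; apply ms_adj; auto.
    - exfalso; apply (mem_asym Hw); rewrite Eu; apply ms_adj; auto. }
  apply (G (proj1_sig x) x eq_refl).
Qed.

Lemma nm_natlike n : natlike (nm n).
Proof.
  intros y Hy.
  assert (E : exists m, m <= n /\ y = nm m).
  { destruct Hy as [-> | (m & Hm & ->)%ms_nm]; eauto with arith. }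
  destruct E as ([|m] & Hm & ->); auto; right; exists (nm m); split.
  - apply ms_nm; eauto.
  - apply nm_S.
Qed.

Lemma omega_exists : exists w : Ms, forall x, ms x w <-> exists n, x = nm n.
Proof.
  assert (H : holds St ax_infinity) by (apply (axiom_holds model); left; do 2 constructor).
  pose proof (proj1 (proj2 (proj2 model))) as [a]; pose proof (proj1 (proj2 (proj2 (proj2 model)))) as [A].
  specialize (H (fun _ => a) (fun _ => A)); apply sat_ExistsS in H as [w H].
  apply sat_And in H as [H0 HS]; apply sat_ExistsS in H0 as [e He]; apply sat_And in He as [Hw He].
  assert (In : forall n, ms (nm n) w).
  { induction n as [|n IH].
    - replace (nm 0) with e; [exact Hw|]; apply (ms_ext model).
      intros z; split; [intros Hz; destruct (He z Hz) | intros []%ms_nm0].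
    - specialize (HS (nm n) IH); apply sat_ExistsS in HS as [y Hy].
      apply sat_And in Hy as [Hy Hz]; replace (nm (S n)) with y; [exact Hy|].
      apply (ms_ext model); intros z; specialize (Hz z).
      rewrite sat_Iff, sat_Or in Hz; rewrite nm_S, ms_adj; exact Hz. }
  destruct (@separation natlike w) as [b Hb].
  { intros k t Ht; unfold natlike; dauto. }
  exists b; intros x; rewrite Hb; split.
  - intros [_ Hx]; apply natlike_nm, Hx.
  - intros [n ->]; split; [apply In | apply nm_natlike].
Qed.

Definition om : Ms := proj1_sig (constructive_indefinite_description _ omega_exists).

Lemma ms_om x : ms x om <-> exists n, x = nm n.
Proof. unfold om; destruct constructive_indefinite_description; auto. Qed.

Lemma nm_om n : ms (nm n) om.
Proof. apply ms_om; eauto. Qed.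

Lemma om_omega : proj1_sig om = omega.
Proof.
  apply set_ext; intros z; rewrite mem_omega; split.
  - intros Hz; destruct (ms_cases _ Hz) as [w <-]; apply ms_om in Hz as [n ->].
    exists n; reflexivity.
  - intros [n ->]; exact (nm_om n).
Qed.

End Replacement.

(** * Stage comparison *)

Section Stages.

Variables M X : V.
Hypothesis model : Pi11_model M X.

Notation Ms := (pt M).
Notation Cs := (pt X).
Notation pr := (pr model).
Notation D := (@D M X).
Notation Tm := (@Tm M X).
Notation D2 := (@D2 M X).

(* [prem s r s'] : s' is a premise of the instance at s of the rule r. *)
Variable prem : Ms -> Ms -> Ms -> Prop.
Hypothesis D_prem : forall k t u v, Tm k t -> Tm k u -> Tm k v ->
  D k (fun Z s => prem (t s) (u s) (v s)).

(** True derivability, defined in the metatheory; it need not be given by a class of X. *)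
Inductive derivable (s : Ms) : Prop :=
| derivable_rule r : (forall s', prem s r s' -> derivable s') -> derivable s.

(** If [J] means derived no later, this means derived strictly earlier: whatever rule derives [s],
    one of its premises is no earlier than [q]. *)
Definition below (J : Ms -> Ms -> Prop) (q s : Ms) : Prop :=
  forall r, exists s', prem s r s' /\ J q s'.

Definition stage_step (J : Ms -> Ms -> Prop) (q s : Ms) : Prop :=
  exists r, forall q', prem q r q' -> below J q' s.

Lemma D2_below J : D2 J -> D2 (below J).
Proof.
  intros HJ k t u Ht Hu; unfold below; dauto; [apply D_prem | apply HJ]; dauto.
Qed.

Lemma D2_stage_step J : D2 J -> D2 (stage_step J).
Proof.
  intros HJ k t u Ht Hu; unfold stage_step; dauto; [apply D_prem | apply D2_below]; dauto.
Qed.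

Lemma stage_step_mono (J J' : Ms -> Ms -> Prop) : (forall q s, J q s -> J' q s) ->
  forall q s, stage_step J q s -> stage_step J' q s.
Proof.
  intros H q s [r Hr]; exists r; intros q' Hq r'.
  destruct (Hr q' Hq r') as (s' & H1 & H2); eauto.
Qed.

(* The stage comparison "q is derived no later than s": a Π¹₁ class of pairs, being the
   least fixed point of [stage_step] with respect to the classes of the model. *)
Lemma stage_order_exists : exists J : Ms -> Ms -> Prop, D2 J /\
  (forall q s, J q s <-> stage_step J q s) /\
  forall P, D2 P -> (forall q s, stage_step P q s -> P q s) -> forall q s, J q s -> P q s.
Proof.
  set (closed (Z : Cs) := forall q s,
    stage_step (fun a b => mc (pr a b) Z) q s -> mc (pr q s) Z).
  destruct (@D_Pi11_comprehension M X model (fun Z x => closed Z -> mc x Z)) as [A HA].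
  { unfold closed, stage_step, below; dauto; apply D_prem; dauto. }
  set (J a b := mc (pr a b) A).
  assert (HJ : D2 J) by (intros k t u Ht Hu; unfold J; dauto).
  assert (Jmin : forall P, D2 P -> (forall q s, stage_step P q s -> P q s) ->
    forall q s, J q s -> P q s).
  { intros P HP Hc q s H.
    destruct (@comprehension_class M X model (fun z => exists x y, P x y /\ z = pr x y))
      as [B HB].
    { dauto; apply HP; dauto. }
    assert (HB' : forall x y, mc (pr x y) B <-> P x y).
    { intros x y; rewrite HB; split; eauto.
      intros (x' & y' & H' & [-> ->]%pr_inj); auto. }
    apply HB', (proj1 (HA _) H B); intros x y Hxy; apply HB', Hc.
    revert Hxy; apply stage_step_mono; intros; apply HB'; auto. }
  assert (Jclosed : forall q s, stage_step J q s -> J q s).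
  { intros q s H; apply HA; intros Z HZ; apply HZ; revert H; apply stage_step_mono.
    intros x y Hxy; exact (proj1 (HA _) Hxy Z HZ). }
  exists J; split; [|split]; auto; split; auto.
  revert q s; apply Jmin; [apply D2_stage_step, HJ|].
  apply stage_step_mono, Jclosed.
Qed.

Theorem stage_comparison : exists Q : Ms -> Ms -> Prop, D2 Q /\
  (forall q s, derivable q -> ~ derivable s -> Q q s) /\
  (forall s r q1 q2, (forall s', prem s r s' -> s' = q1 \/ s' = q2) ->
    Q q1 s -> Q q2 s -> False).
Proof.
  destruct stage_order_exists as (J & HJ & Jfix & Jmin).
  (* [K] is precedence by at least one stage, [below K] by at least two. *)
  set (K := below J).
  assert (HK : D2 K) by (apply D2_below, HJ).
  exists (below K); split; [|split].
  - apply D2_below, HK.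
  - assert (ND : forall s r, ~ derivable s -> exists s', prem s r s' /\ ~ derivable s').
    { intros s r Hs; apply NNPP; intros H; apply Hs, derivable_rule with r.
      intros s' Hs'; apply NNPP; intros H'; apply H; eauto. }
    (* The only induction on true derivability: an underivable [s] keeps an underivable premise
       under every rule, so each step of the derivation of [q] can be matched. *)
    assert (HJd : forall q, derivable q -> forall s, ~ derivable s -> J q s).
    { intros q Hq; induction Hq as [q r _ IH]; intros s Hs; apply Jfix.
      exists r; intros q' Hq' r'; destruct (ND s r' Hs) as (s' & H1 & H2); eauto. }
    intros q s Hq Hs r; destruct (ND s r Hs) as (s' & H1 & Hs'); exists s'; split; auto.
    intros r'; destruct (ND s' r' Hs') as (s'' & H2 & Hs''); eauto.
  - assert (Jtrans : forall a b c, J a b -> J b c -> J a c).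
    { intros a b c H; revert c; pattern a, b; revert a b H; apply Jmin.
      { intros k t u Ht Hu; dauto; apply HJ; dauto. }
      intros a b [r Hr] c Hbc; apply Jfix in Hbc as [rb Hb]; apply Jfix.
      exists r; intros a' Ha' rc.
      destruct (Hr a' Ha' rb) as (b' & Hb' & IH).
      destruct (Hb b' Hb' rc) as (c' & Hc' & Hbc'); eauto. }
    (* A cycle [p1], [p2] with [p1] no later than [a] can be pushed down. Some premise of [p1] is no
       earlier than [p2] and strictly earlier than [a], so [p2] is no later than a premise of [a],
       and the swapped cycle sits below that premise. The predicate is elementary in [J], so
       leastness among the classes of X suffices. *)
    assert (Kwf : forall a x, J a x ->
      J a x /\ forall p1 p2, K p1 p2 -> K p2 p1 -> ~ J p1 a).
    { apply Jmin.
      { intros k t u Ht Hu; dauto; first [apply HJ | apply HK]; dauto. }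
      intros a x [r Hr]; split.
      { apply Jfix; exists r; intros a' Ha' rx.
        destruct (Hr a' Ha' rx) as (x' & H1 & H2 & _); eauto. }
      intros p1 p2 H12 H21 H1; apply Jfix in H1 as [r1 H1].
      destruct (H21 r1) as (p1' & Hp1 & H2).
      destruct (H1 p1' Hp1 r) as (a' & Ha' & H3).
      destruct (Hr a' Ha' r) as (x' & _ & _ & H4).
      apply (H4 p2 p1 H21 H12); eauto. }
    (* [Kwf] needs a bound of the cycle that occurs on the left of [J]; a premise of [p1] no earlier
       than [p2] is one. Any element can serve as a rule index, and [p1] is at hand. *)
    assert (Kasym : forall p1 p2, K p1 p2 -> K p2 p1 -> False).
    { intros p1 p2 H12 H21.
      destruct (H12 p1) as (p2' & _ & H1); apply Jfix in H1 as [r1 H1].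
      destruct (H21 r1) as (p1' & Hp1 & H2).
      destruct (H1 p1' Hp1 p1) as (x & _ & H3).
      apply Kwf in H3 as [_ H3]; exact (H3 p2 p1 H21 H12 H2). }
    (* Under [r], each of [q1] and [q2] strictly precedes one of [q1] and [q2], which yields a cycle
       of length one or two. *)
    intros s r q1 q2 Hr H1 H2.
    destruct (H1 r) as (s1 & Hs1 & K1), (H2 r) as (s2 & Hs2 & K2).
    destruct (Hr s1 Hs1) as [-> | ->], (Hr s2 Hs2) as [-> | ->]; eauto.
Qed.

End Stages.

(** * Cantor pairing and assignments inside the model *)

Section Arithmetic.

Variables M X : V.
Hypothesis model : Pi11_model M X.

Notation Ms := (pt M).
Notation pr := (pr model).
Notation adj := (adj model).
Notation nm := (nm model).
Notation om := (om model).
Notation D := (@D M X).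
Notation Tm := (@Tm M X).

(* Membership in a set closed under the predecessor step of [of_nat], started downwards
   from z; such sets exist in the model because it contains all its finite subsets. *)
Definition cantor_graph (z x y : Ms) : Prop :=
  exists d, ms (pr z (pr x y)) d /\
  forall n u v, ms (pr n (pr u v)) d ->
    (n = nm 0 /\ u = nm 0 /\ v = nm 0) \/
    exists m u' v', n = adj m m /\ ms (pr m (pr u' v')) d /\
      ((u' = adj u u /\ v = adj v' v') \/ (u' = nm 0 /\ u = adj v' v' /\ v = nm 0)).

Lemma adj_nm_inv w i : nm i = adj w w -> exists j, w = nm j /\ i = S j.
Proof.
  intros E; assert (H : ms w (nm i)) by (rewrite E, ms_adj; auto).
  apply ms_nm in H as (j & _ & ->); exists j; split; auto.
  rewrite <- nm_S in E; apply nm_inj in E; auto.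
Qed.

Lemma cantor_graph_spec z x y : cantor_graph z x y <->
  exists i j, x = nm i /\ y = nm j /\ z = nm (to_nat (i, j)).
Proof.
  split.
  - intros (d & Hd & Hc).
    (* Every record in [d] goes back to a record with a smaller first component, so induction on
       true membership recovers the run of [of_nat]. *)
    assert (G : forall w n u v, proj1_sig n = w -> ms (pr n (pr u v)) d ->
      exists k, n = nm k /\ u = nm (fst (of_nat k)) /\ v = nm (snd (of_nat k))).
    { intros w; induction w as [w IH] using mem_induction; intros n u v <- H.
      destruct (Hc n u v H) as [(-> & -> & ->) | (m & u' & v' & -> & H' & E)].
      { exists 0; auto. }
      destruct (IH (proj1_sig m)) with (n := m) (u := u') (v := v') as (k & -> & -> & ->); auto.
      { apply (ms_adj model m m m); auto. }
      exists (S k); rewrite <- nm_S, of_nat_S; destruct (of_nat k) as [i j]; simpl in E.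
      destruct E as [[E ->] | (E & -> & ->)].
      - apply adj_nm_inv in E as (i' & -> & ->); rewrite <- nm_S; auto.
      - apply nm_inj in E as ->; rewrite <- nm_S; auto. }
    destruct (G _ z x y eq_refl Hd) as (k & -> & -> & ->).
    exists (fst (of_nat k)), (snd (of_nat k)); rewrite <- surjective_pairing, cancel_to_of; auto.
  - intros (i & j & -> & -> & ->).
    assert (G : forall n, cantor_graph (nm n) (nm (fst (of_nat n))) (nm (snd (of_nat n)))).
    2: { specialize (G (to_nat (i, j))); rewrite cancel_of_to in G; exact G. }
    clear i j; intros n.
    induction n as [|n (d & Hd & Hc)].
    + exists (adj (nm 0) (pr (nm 0) (pr (nm 0) (nm 0)))); split; [apply ms_adj; auto|].
      intros n u v [[]%ms_nm0 | [-> [-> ->]%pr_inj]%pr_inj]%ms_adj; auto.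
    + exists (adj d (pr (nm (S n)) (pr (nm (fst (of_nat (S n)))) (nm (snd (of_nat (S n))))))).
      split; [apply ms_adj; auto|].
      intros m u v [H | [-> [-> ->]%pr_inj]%pr_inj]%ms_adj.
      * destruct (Hc m u v H) as [E | (m' & u' & v' & E1 & E2 & E3)]; [auto|].
        right; exists m', u', v'; rewrite ms_adj; auto.
      * right; exists (nm n), (nm (fst (of_nat n))), (nm (snd (of_nat n))).
        rewrite nm_S, ms_adj, of_nat_S; split; auto; split; auto.
        destruct (of_nat n) as [[|i] j]; simpl; rewrite <- ?nm_S; auto.
Qed.

(* Junk value: [nm 0] when an argument is not a numeral. *)
Definition cp (x y : Ms) : Ms :=
  epsilon (inhabits (nm 0)) (fun z => cantor_graph z x y \/
    (~ (ms x om /\ ms y om) /\ z = nm 0)).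

Lemma cp_graph x y z : z = cp x y <->
  cantor_graph z x y \/ (~ (ms x om /\ ms y om) /\ z = nm 0).
Proof.
  assert (U : forall z z', (cantor_graph z x y \/ (~ (ms x om /\ ms y om) /\ z = nm 0)) ->
    (cantor_graph z' x y \/ (~ (ms x om /\ ms y om) /\ z' = nm 0)) -> z = z').
  { intros u u'; rewrite !cantor_graph_spec, !ms_om.
    intros [(i & j & -> & -> & ->) | [H ->]] [(i' & j' & E1 & E2 & ->) | [H' ->]]; auto.
    - apply nm_inj in E1 as ->; apply nm_inj in E2 as ->; auto.
    - destruct H'; eauto.
    - destruct H; eauto. }
  assert (E : exists z, cantor_graph z x y \/ (~ (ms x om /\ ms y om) /\ z = nm 0)).
  { destruct (classic (ms x om /\ ms y om)) as [[H1 H2] | H]; [|eauto].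
    apply ms_om in H1 as [i ->]; apply ms_om in H2 as [j ->].
    exists (nm (to_nat (i, j))); left; apply cantor_graph_spec; eauto 6. }
  assert (S := epsilon_spec (inhabits (nm 0)) _ E); fold (cp x y) in S.
  split; [intros ->; exact S | intros H; exact (U _ _ H S)].
Qed.

Lemma cp_nm i j : cp (nm i) (nm j) = nm (to_nat (i, j)).
Proof. symmetry; apply cp_graph; left; apply cantor_graph_spec; eauto 6. Qed.

Lemma Tm_cp k t u : Tm k t -> Tm k u -> Tm k (fun s => cp (t s) (u s)).
Proof.
  intros Ht Hu; eapply D_iff; [intros Z s; symmetry; apply cp_graph|].
  unfold cantor_graph; dauto.
Qed.

(** An assignment is any set that is functional on ω; pairs with other first components are left
    free. Updates are therefore not unique, but their values under [lookup] are. *)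
Definition isfun (e : Ms) : Prop :=
  forall i, ms i om -> exists a, ms (pr i a) e /\ forall b, ms (pr i b) e -> b = a.

Definition lookup (e : Ms) (i : nat) : Ms :=
  epsilon (inhabits e) (fun a => ms (pr (nm i) a) e).

Lemma lookup_spec e i a : isfun e -> ms (pr (nm i) a) e <-> a = lookup e i.
Proof.
  intros He; destruct (He (nm i) (nm_om _ i)) as (b & Hb & Hu).
  assert (S := epsilon_spec (inhabits e) (fun a => ms (pr (nm i) a) e) (ex_intro _ b Hb)).
  fold (lookup e i) in S; split.
  - intros Ha; rewrite (Hu a Ha), (Hu _ S); reflexivity.
  - intros ->; exact S.
Qed.

Definition isupd (e x a e' : Ms) : Prop :=
  isfun e' /\ forall i b, ms i om ->
    (ms (pr i b) e' <-> (i = x /\ b = a) \/ (i <> x /\ ms (pr i b) e)).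

Lemma isupd_lookup e x a e' : isfun e -> isupd e (nm x) a e' ->
  lookup e' = upd (lookup e) x a.
Proof.
  intros He [He' H]; extensionality i; symmetry; apply lookup_spec; auto.
  apply H; [apply nm_om|]; unfold upd; destruct (Nat.eqb_spec x i) as [-> | n]; auto.
  right; split; [intros E%nm_inj; congruence | apply lookup_spec; auto].
Qed.

Lemma isupd_exists e x a : isfun e -> exists e', isupd e (nm x) a e'.
Proof.
  intros He.
  destruct (@replacement M X model (fun i z => ms i om /\ exists b, z = pr i b /\
    ((i = nm x /\ b = a) \/ (i <> nm x /\ ms (pr i b) e))) om) as [e' He'].
  { intros k t u Ht Hu; dauto. }
  { intros i z z' [Hi (b & -> & Hb)] [_ (b' & -> & Hb')]; f_equal.
    destruct (He i Hi) as (c & _ & Hc).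
    destruct Hb as [[E ->] | [n Hb]], Hb' as [[E' ->] | [n' Hb']]; auto; try tauto.
    rewrite (Hc b), (Hc b'); auto. }
  assert (E : forall i b, ms i om ->
    (ms (pr i b) e' <-> (i = nm x /\ b = a) \/ (i <> nm x /\ ms (pr i b) e))).
  { intros i b Hi; rewrite He'; split.
    - intros (j & _ & _ & c & [-> ->]%pr_inj & H); exact H.
    - intros H; exists i; split; auto; split; auto; exists b; auto. }
  exists e'; split; auto; intros i Hi.
  destruct (classic (i = nm x)) as [-> | n].
  - exists a; rewrite E by auto; split; auto; intros b; rewrite E by auto; tauto.
  - destruct (He i Hi) as (c & Hc & Hu); exists c; rewrite E by auto; split; auto.
    intros b; rewrite E by auto; intros [[H _] | [_ H]]; [tauto | auto].
Qed.

(** Only finitely many values can be prescribed, since M need not contain external ω-sequences of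
    its elements. *)
Lemma fun_exists (s : nat -> Ms) N : exists e, isfun e /\ forall i, i < N -> lookup e i = s i.
Proof.
  induction N as [|N (e & He & H)].
  - destruct (@replacement M X model (fun i z => z = pr i (nm 0)) om) as [e He].
    { intros k t u Ht Hu; dauto. }
    { intros i z z' -> ->; reflexivity. }
    exists e; split; [|lia]; intros i Hi; exists (nm 0); split.
    + apply He; eauto.
    + intros b (j & _ & [_ E]%pr_inj)%He; auto.
  - destruct (isupd_exists N (s N) He) as [e' He']; exists e'; split; [apply He'|].
    intros i Hi; rewrite (isupd_lookup He He'); unfold upd.
    destruct (Nat.eqb_spec N i) as [<- | n]; auto; apply H; lia.
Qed.

End Arithmetic.

Ltac dhook ::=
  match goal with
  | |- @Tm _ _ _ (fun s => cp _ _ _) => apply Tm_cp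
  | |- @D _ _ _ (fun Z s => isfun _ _) => unfold isfun
  | |- @D _ _ _ (fun Z s => isupd _ _ _ _ _) => unfold isupd
  end.

(** * Infinitary logic over the model *)

Section Logic.

Variables M X : V.
Hypothesis model : Pi11_model M X.

Notation Ms := (pt M).
Notation pr := (pr model).
Notation adj := (adj model).
Notation nm := (nm model).
Notation om := (om model).
Notation cp := (cp model).
Notation isfun := (isfun model).
Notation isupd := (isupd model).
Notation lookup := (lookup model).
Notation D := (@D M X).
Notation Tm := (@Tm M X).
Notation D2 := (@D2 M X).

(* A statement is a formula code with a set and a class assignment; classes are named by
   elements of M.  The atom "a belongs to the class named m" carries the tag ω, which is
   not a formula code. *)
Notation pos t := (pr (nm 1) t).
Notation neg t := (pr (nm 0) t).
Notation stm n e d := (pr n (pr e d)).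
Notation atom a m := (pr om (pr a m)).
Notation cantor3 t i j := (to_nat (t, to_nat (i, j))).
Notation cp3 t i j := (cp t (cp i j)).

Lemma cp3_nm t i j : cp3 (nm t) (nm i) (nm j) = nm (cantor3 t i j).
Proof. rewrite !cp_nm; reflexivity. Qed.

Lemma cantor3_inj t i j t' i' j' :
  cantor3 t i j = cantor3 t' i' j' -> t = t' /\ i = i' /\ j = j'.
Proof.
  intros E%to_nat_inj; injection E as -> E%to_nat_inj; injection E as -> ->; auto.
Qed.

(* The statement with formula ⟨t, ⟨i, j⟩⟩, negated if [sign] gives [nm 0], is equivalent to
   the conjunction of its [kids]. *)
Definition sign (b : Ms) (t i j : nat) (e : Ms) : Prop :=
  match t with
  | 0 => (lookup e i = lookup e j /\ b = nm 1) \/ (lookup e i <> lookup e j /\ b = nm 0)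
  | 2 => (ms (lookup e i) (lookup e j) /\ b = nm 1) \/
         (~ ms (lookup e i) (lookup e j) /\ b = nm 0)
  | 1 | 3 | 6 | 7 => b = nm 1
  | _ => b = nm 0
  end.

(** Class equality unfolds into two implications at each set, carried by set variable 0. A class
    quantifier ranges over names. Tags without kids give an empty conjunction: the literal selected
    by [sign] is true outright. *)
Definition kids (t i j : nat) (e d l : Ms) : Prop :=
  match t with
  | 1 => exists a e', isupd e (nm 0) a e' /\
      (l = pos (stm (nm (cantor3 5 (cantor3 3 0 i) (cantor3 3 0 j))) e' d) \/
       l = pos (stm (nm (cantor3 5 (cantor3 3 0 j) (cantor3 3 0 i))) e' d))
  | 3 => l = pos (atom (lookup e i) (lookup d j))
  | 5 => l = pos (stm (nm i) e d) \/ l = neg (stm (nm j) e d)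
  | 6 => exists a e', isupd e (nm i) a e' /\ l = pos (stm (nm j) e' d)
  | 7 => exists m d', isupd d (nm i) m d' /\ l = pos (stm (nm j) e d')
  | _ => False
  end.

Definition dom (l : Ms) : Prop := exists t i j e d b, isfun e /\ isfun d /\
  l = pr b (stm (nm (cantor3 t i j)) e d) /\ sign b t i j e.

Definition def (l l' : Ms) : Prop := exists t i j e d b, isfun e /\ isfun d /\
  l = pr b (stm (nm (cantor3 t i j)) e d) /\ sign b t i j e /\ kids t i j e d l'.

Lemma def_kids t i j e d b l' : isfun e -> isfun d -> sign b t i j e ->
  def (pr b (stm (nm (cantor3 t i j)) e d)) l' <-> kids t i j e d l'.
Proof.
  intros He Hd Hb; split.
  - intros (t' & i' & j' & e' & d' & b' & _ & _ & E & _ & H).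
    apply pr_inj in E as [<- E]; apply pr_inj in E as [E1 E]; apply pr_inj in E as [<- <-].
    apply nm_inj, cantor3_inj in E1 as (<- & <- & <-); exact H.
  - intros H; exists t, i, j, e, d, b; auto.
Qed.

(** The version with [t], [i], [j] in the model serves definability; the version with natural
    numbers serves case analysis and induction on formulas. *)
Let sign' (b t i j e : Ms) : Prop :=
  (t = nm 0 /\ exists a c, ms (pr i a) e /\ ms (pr j c) e /\
     ((a = c /\ b = nm 1) \/ (~ a = c /\ b = nm 0))) \/
  (t = nm 2 /\ exists a c, ms (pr i a) e /\ ms (pr j c) e /\
     ((ms a c /\ b = nm 1) \/ (~ ms a c /\ b = nm 0))) \/
  ((t = nm 1 \/ t = nm 3 \/ t = nm 6 \/ t = nm 7) /\ b = nm 1) \/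
  (~ (t = nm 0 \/ t = nm 1 \/ t = nm 2 \/ t = nm 3 \/ t = nm 6 \/ t = nm 7) /\ b = nm 0).

Let kids' (t i j e d l : Ms) : Prop :=
  (t = nm 1 /\ exists a e', isupd e (nm 0) a e' /\
      (l = pos (stm (cp3 (nm 5) (cp3 (nm 3) (nm 0) i) (cp3 (nm 3) (nm 0) j)) e' d) \/
       l = pos (stm (cp3 (nm 5) (cp3 (nm 3) (nm 0) j) (cp3 (nm 3) (nm 0) i)) e' d))) \/
  (t = nm 3 /\ exists a m, ms (pr i a) e /\ ms (pr j m) d /\ l = pos (atom a m)) \/
  (t = nm 5 /\ (l = pos (stm i e d) \/ l = neg (stm j e d))) \/
  (t = nm 6 /\ exists a e', isupd e i a e' /\ l = pos (stm j e' d)) \/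
  (t = nm 7 /\ exists m d', isupd d i m d' /\ l = pos (stm j e d')).

Lemma sign_iff b t i j e : isfun e ->
  sign b t i j e <-> sign' b (nm t) (nm i) (nm j) e.
Proof.
  intros He; unfold sign'.
  assert (L : forall i a, ms (pr (nm i) a) e <-> a = lookup e i)
    by (intros; apply lookup_spec; auto).
  assert (T : forall u v, nm u = nm v <-> u = v)
    by (intros u v; split; [apply nm_inj | congruence]).
  rewrite !T.
  assert (E1 : forall R : Ms -> Ms -> Prop,
    (exists a c, ms (pr (nm i) a) e /\ ms (pr (nm j) c) e /\ R a c) <->
    R (lookup e i) (lookup e j)).
  { intros R; split.
    - intros (a & c & Ha & Hc & H); apply L in Ha as ->; apply L in Hc as ->; exact H.
    - intros H; exists (lookup e i), (lookup e j); rewrite !L; auto. }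
  rewrite (E1 (fun a c => (a = c /\ b = nm 1) \/ (a <> c /\ b = nm 0))).
  rewrite (E1 (fun a c => (ms a c /\ b = nm 1) \/ (~ ms a c /\ b = nm 0))).
  destruct t as [|[|[|[|[|[|[|[|t]]]]]]]]; simpl; intuition (try discriminate; try lia; auto).
Qed.

Lemma kids_iff t i j e d l : isfun e -> isfun d ->
  kids t i j e d l <-> kids' (nm t) (nm i) (nm j) e d l.
Proof.
  intros He Hd; unfold kids'.
  assert (T : forall u v, nm u = nm v <-> u = v)
    by (intros u v; split; [apply nm_inj | congruence]).
  rewrite !T, !cp3_nm.
  assert (E1 : (exists a m, ms (pr (nm i) a) e /\ ms (pr (nm j) m) d /\ l = pos (atom a m)) <->
    l = pos (atom (lookup e i) (lookup d j))).
  { split.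
    - intros (a & c & Ha & Hc & H); apply lookup_spec in Ha as ->; auto.
      apply lookup_spec in Hc as ->; auto.
    - intros H; exists (lookup e i), (lookup d j); rewrite !lookup_spec; auto. }
  rewrite E1.
  destruct t as [|[|[|[|[|[|[|[|t]]]]]]]]; simpl; intuition (try discriminate; try lia; auto).
Qed.

Lemma D_dom k t : Tm k t -> D k (fun Z s => dom (t s)).
Proof.
  intros Ht; apply D_iff with (fun Z s => exists u i j e d b,
    ms u om /\ ms i om /\ ms j om /\ isfun e /\ isfun d /\
    t s = pr b (stm (cp3 u i j) e d) /\ sign' b u i j e).
  - intros Z s; split.
    + intros (u & i & j & e & d & b & Hu & Hi & Hj & He & Hd & E & H).
      apply ms_om in Hu as [u' ->]; apply ms_om in Hi as [i' ->]; apply ms_om in Hj as [j' ->].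
      rewrite cp3_nm in E; exists u', i', j', e, d, b; rewrite sign_iff; auto.
    + intros (u & i & j & e & d & b & He & Hd & E & H).
      exists (nm u), (nm i), (nm j), e, d, b; rewrite sign_iff in H by auto.
      rewrite cp3_nm; auto 10 using nm_om.
  - unfold sign'; dauto.
Qed.

Lemma D2_def : D2 def.
Proof.
  intros k t v Ht Hv; apply D_iff with (fun Z s => exists u i j e d b,
    ms u om /\ ms i om /\ ms j om /\ isfun e /\ isfun d /\
    t s = pr b (stm (cp3 u i j) e d) /\ sign' b u i j e /\ kids' u i j e d (v s)).
  - intros Z s; split.
    + intros (u & i & j & e & d & b & Hu & Hi & Hj & He & Hd & E & H & H').
      apply ms_om in Hu as [u' ->]; apply ms_om in Hi as [i' ->]; apply ms_om in Hj as [j' ->].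
      rewrite cp3_nm in E; exists u', i', j', e, d, b; rewrite sign_iff, kids_iff; auto.
    + intros (u & i & j & e & d & b & He & Hd & E & H & H').
      exists (nm u), (nm i), (nm j), e, d, b; rewrite sign_iff in H by auto.
      rewrite kids_iff in H' by auto; rewrite cp3_nm; auto 10 using nm_om.
  - unfold sign', kids'; dauto.
Qed.

Lemma om_neq_nm k : om <> nm k.
Proof.
  intros E; apply (@mem_irrefl (proj1_sig (nm k))).
  change (ms (nm k) (nm k)); rewrite <- E at 2; apply nm_om.
Qed.

(** ** Truth *)

Section Truth.

Variables (Y : V) (nu : Ms -> pt Y).
Hypothesis YM : forall A, A ∈ Y -> A ⊆ M.
Hypothesis nu_surj : forall A, exists m, nu m = A.

Notation SY := (standard_structure M Y).

Definition sat_at (k : nat) (e d : Ms) : Prop :=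
  sat SY (lookup e) (fun i => nu (lookup d i)) (decode k).

Definition val (t : Ms) : Prop :=
  (exists k e d, t = stm (nm k) e d /\ sat_at k e d) \/
  (exists a m, t = atom a m /\ mc a (nu m)).

Definition true_lit (l : Ms) : Prop :=
  exists t, (l = pos t /\ val t) \/ (l = neg t /\ ~ val t).

Lemma nm01 : nm 0 <> nm 1.
Proof. intros E%nm_inj; discriminate. Qed.

Lemma val_stm k e d : val (stm (nm k) e d) <-> sat_at k e d.
Proof.
  split; [|left; eauto 6].
  intros [(k' & e' & d' & E & H) | (a & m & E & _)].
  - apply pr_inj in E as [->%nm_inj E]; apply pr_inj in E as [-> ->]; exact H.
  - apply pr_inj in E as [E _]; symmetry in E; apply om_neq_nm in E as [].
Qed.

Lemma val_atom a m : val (atom a m) <-> mc a (nu m).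
Proof.
  split; [|right; eauto].
  intros [(k & e & d & E & _) | (a' & m' & E & H)].
  - apply pr_inj in E as [E _]; apply om_neq_nm in E as [].
  - apply pr_inj in E as [_ E]; apply pr_inj in E as [-> ->]; exact H.
Qed.

Lemma true_pos t : true_lit (pos t) <-> val t.
Proof.
  split.
  - intros (u & [[E H] | [E H]]); apply pr_inj in E as [E ->]; auto.
    symmetry in E; apply nm01 in E as [].
  - intros H; exists t; auto.
Qed.

Lemma true_neg t : true_lit (neg t) <-> ~ val t.
Proof.
  split.
  - intros (u & [[E H] | [E H]]); apply pr_inj in E as [E ->]; auto.
    apply nm01 in E as [].
  - intros H; exists t; auto.
Qed.

Lemma forall_upd (P : (nat -> Ms) -> Prop) e i : isfun e ->
  (forall a e', isupd e (nm i) a e' -> P (lookup e')) <->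
  forall a, P (upd (lookup e) i a).
Proof.
  intros He; split.
  - intros H a; destruct (isupd_exists i a He) as [e' He'].
    rewrite <- (isupd_lookup He He'); eauto.
  - intros H a e' He'; rewrite (isupd_lookup He He'); auto.
Qed.

(** Tarski's clauses as infinitary conjunctions. [nu_surj] lets names stand for all classes, and
    [YM] makes class equality a matter of elements in M. *)
Lemma true_kids t i j e d b : isfun e -> isfun d -> sign b t i j e ->
  true_lit (pr b (stm (nm (cantor3 t i j)) e d)) <->
  forall l, kids t i j e d l -> true_lit l.
Proof.
  intros He Hd Hb.
  assert (Fe : forall P : (nat -> Ms) -> Prop, forall i,
    (forall a e', isupd e (nm i) a e' -> P (lookup e')) <->
    forall a, P (upd (lookup e) i a)) by (intros; apply forall_upd; auto).
  destruct t as [|[|[|[|[|[|[|[|t]]]]]]]]; simpl in Hb |- *.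
  - destruct Hb as [[E ->] | [E ->]]; rewrite ?true_pos, ?true_neg, val_stm;
      unfold sat_at; rewrite decode_unfold; simpl; tauto.
  - subst b; rewrite true_pos, val_stm; unfold sat_at; rewrite decode_unfold; simpl.
    transitivity (forall a : Ms, mc a (nu (lookup d i)) <-> mc a (nu (lookup d j))).
    + split; [intros -> a; tauto|]; intros H; apply sig_eq, set_ext; intros z; split; intros Hz.
      * exact (proj1 (H (exist _ z (YM (proj2_sig (nu (lookup d i))) Hz))) Hz).
      * exact (proj2 (H (exist _ z (YM (proj2_sig (nu (lookup d j))) Hz))) Hz).
    + transitivity (forall a e', isupd e (nm 0) a e' ->
        (mc (lookup e' 0) (nu (lookup d i)) <-> mc (lookup e' 0) (nu (lookup d j)))).
      { symmetry; exact (Fe (fun s =>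
          mc (s 0) (nu (lookup d i)) <-> mc (s 0) (nu (lookup d j))) 0). }
      split.
      * intros H l (a & e' & He' & E); specialize (H a e' He').
        destruct E as [-> | ->]; rewrite true_pos, val_stm; unfold sat_at;
          rewrite !decode_unfold; simpl; unfold mc in H; tauto.
      * intros H a e' He'.
        assert (H1 := H _ (ex_intro _ a (ex_intro _ e' (conj He' (or_introl eq_refl))))).
        assert (H2 := H _ (ex_intro _ a (ex_intro _ e' (conj He' (or_intror eq_refl))))).
        rewrite true_pos, val_stm in H1, H2; unfold sat_at in H1, H2;
          rewrite !decode_unfold in H1, H2; simpl in H1, H2; unfold mc; tauto.
  - destruct Hb as [[E ->] | [E ->]]; rewrite ?true_pos, ?true_neg, val_stm;
      unfold sat_at; rewrite decode_unfold; simpl; unfold ms in E; tauto.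
  - subst b; rewrite true_pos, val_stm; unfold sat_at; rewrite decode_unfold; simpl; split.
    + intros H l ->; apply true_pos, val_atom, H.
    + intros H; apply val_atom, true_pos, H, eq_refl.
  - subst b; rewrite true_neg, val_stm; unfold sat_at; rewrite decode_unfold; simpl; tauto.
  - subst b; rewrite true_neg, val_stm; unfold sat_at; rewrite decode_unfold; simpl; split.
    + intros H l [-> | ->]; rewrite ?true_pos, ?true_neg, val_stm; unfold sat_at; tauto.
    + intros H H'; assert (H1 := H _ (or_introl eq_refl)); assert (H2 := H _ (or_intror eq_refl)).
      rewrite true_pos, val_stm in H1; rewrite true_neg, val_stm in H2; unfold sat_at in *; tauto.
  - subst b; rewrite true_pos, val_stm; unfold sat_at; rewrite decode_unfold; simpl.
    rewrite <- (Fe (fun s => sat SY s (fun x => nu (lookup d x)) (decode j))); split.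
    + intros H l (a & e' & He' & ->); apply true_pos, val_stm, (H a e' He').
    + intros H a e' He'; apply val_stm, true_pos, H; eauto.
  - subst b; rewrite true_pos, val_stm; unfold sat_at; rewrite decode_unfold; simpl.
    transitivity (forall m, sat SY (lookup e) (fun x => nu (upd (lookup d) i m x)) (decode j)).
    { assert (E : forall m, (fun x => nu (upd (lookup d) i m x)) =
        upd (fun x => nu (lookup d x)) i (nu m)).
      { intros m; extensionality x; unfold upd; destruct (i =? x); auto. }
      split; intros H m; [rewrite E; apply H|].
      destruct (nu_surj m) as [n <-]; rewrite <- E; apply H. }
    rewrite <- (@forall_upd (fun s => sat SY (lookup e) (fun x => nu (s x)) (decode j)) d i Hd).
    split.
    + intros H l (a & e' & He' & ->); apply true_pos, val_stm, (H a e' He').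
    + intros H a e' He'; apply val_stm, true_pos, H; eauto.
  - subst b; rewrite true_neg, val_stm; unfold sat_at; rewrite decode_unfold; simpl; tauto.
Qed.

End Truth.

End Logic.

(** * Conditions, refutations and the generic model *)

(** Class equality weighs 4 because its kids are implications between two memberships, of weight 3;
    thus kids always weigh less. *)
Fixpoint fsize (p : form) : nat :=
  match p with
  | EqC _ _ => 4
  | Imp p q => S (fsize p + fsize q)
  | ForallS _ p | ForallC _ p => S (fsize p)
  | _ => 1
  end.

Lemma pt_image (M : V) (g : pt M -> V) : exists Y, forall z, z ∈ Y <-> exists m, z = g m.
Proof.
  destruct (@image_exists M (fun v => epsilon (inhabits v)
    (fun y => exists m : pt M, proj1_sig m = v /\ y = g m))) as [Y HY].
  assert (E : forall m : pt M, epsilon (inhabits (proj1_sig m))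
    (fun y => exists n : pt M, proj1_sig n = proj1_sig m /\ y = g n) = g m).
  { intros m; match goal with |- epsilon ?a ?P = _ =>
      destruct (epsilon_spec a P) as (n & E1 & E2) end; [eauto|].
    rewrite E2; f_equal; apply sig_eq, E1. }
  exists Y; intros z; rewrite HY; split.
  - intros (w & Hw & ->); exists (exist _ w Hw); apply (E (exist _ w Hw)).
  - intros [m ->]; exists (proj1_sig m); split; [apply proj2_sig | symmetry; apply E].
Qed.

Section Generic.

Variables M X : V.
Hypothesis model : Pi11_model M X.

Notation Ms := (pt M).
Notation pr := (pr model).
Notation adj := (adj model).
Notation nm := (nm model).
Notation om := (om model).
Notation isfun := (isfun model).
Notation isupd := (isupd model).
Notation lookup := (lookup model).
Notation D := (@D M X).
Notation Tm := (@Tm M X).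
Notation dom := (dom model).
Notation def := (def model).
Notation pos t := (pr (nm 1) t).
Notation neg t := (pr (nm 0) t).
Notation stm n e d := (pr n (pr e d)).
Notation atom a m := (pr om (pr a m)).
Notation cantor3 t i j := (to_nat (t, to_nat (i, j))).

(* The codes of the axioms. *)
Variable ax : Ms.

Definition compl (l l' : Ms) : Prop :=
  exists t, (l = pos t /\ l' = neg t) \/ (l = neg t /\ l' = pos t).

Definition axiom_stm (t : Ms) : Prop :=
  exists n e d, ms n ax /\ isfun e /\ isfun d /\ t = stm n e d.

(* [clause r] is the infinitary disjunction with index r; it is empty for junk r. *)
Definition clause (r l : Ms) : Prop :=
  (exists l1 l2, r = pr (nm 0) (pr l1 l2) /\ def l1 l2 /\ (compl l1 l \/ l = l2)) \/
  (exists l1, r = pr (nm 1) l1 /\ dom l1 /\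
     (l = l1 \/ exists l2, def l1 l2 /\ compl l2 l)) \/
  (exists t, r = pr (nm 2) t /\ (l = pos t \/ l = neg t)) \/
  (exists t, r = pr (nm 3) t /\ axiom_stm t /\ l = pos t).

(* A condition s is refuted as soon as, for some clause, all extensions of s by a literal
   of the clause not contradicting s are refuted. *)
Definition prem (s r s' : Ms) : Prop :=
  (exists l, clause r l /\ ~ (exists l0, ms l0 s /\ compl l l0) /\ s' = adj s l) \/
  (~ (exists l, clause r l) /\ s' = s).

Lemma D_prem k t u v : Tm k t -> Tm k u -> Tm k v ->
  D k (fun Z s => prem (t s) (u s) (v s)).
Proof.
  intros Ht Hu Hv; unfold prem, clause, axiom_stm, compl.
  dauto; first [apply D2_def | apply D_dom]; dauto.
Qed.

Notation refuted := (derivable prem).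

(** The complete valuations that a generic sequence of conditions produces; each of them meets every
    nonempty clause. *)
Definition good (G : Ms -> Prop) : Prop :=
  (forall t, G (pos t) <-> ~ G (neg t)) /\
  (forall l, dom l -> (G l <-> forall l', def l l' -> G l')) /\
  (forall t, axiom_stm t -> G (pos t)).

Lemma good_compl G l l' : good G -> compl l l' -> G l <-> ~ G l'.
Proof.
  intros (H & _) (t & [[-> ->] | [-> ->]]); specialize (H t); tauto.
Qed.

Lemma def_dom l l' : def l l' -> dom l.
Proof. intros (t & i & j & e & d & b & H); exists t, i, j, e, d, b; tauto. Qed.

Lemma dom_compl l : dom l -> exists l', compl l l'.
Proof.
  intros (t & i & j & e & d & b & _ & _ & -> & H).
  assert (Hb : b = nm 0 \/ b = nm 1).
  { destruct t as [|[|[|[|[|[|[|[|t]]]]]]]]; simpl in H; tauto. }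
  destruct Hb as [-> | ->]; [eexists (pos _) | eexists (neg _)]; eexists; eauto.
Qed.

Lemma compl_sym l l' : compl l l' -> compl l' l.
Proof. intros (t & H); exists t; tauto. Qed.

Lemma good_clause G r : good G -> (exists l, clause r l) -> exists l, clause r l /\ G l.
Proof.
  intros HG [l [(l1 & l2 & -> & Hd & _) | [(l1 & -> & Hd & _) |
    [(t & -> & _) | (t & -> & Ht & ->)]]]].
  - destruct (classic (G l2)) as [H2 | H2].
    + exists l2; split; auto; left; exists l1, l2; auto.
    + destruct (dom_compl (def_dom Hd)) as [l' Hl'].
      exists l'; split; [left; exists l1, l2; auto|].
      apply (good_compl HG (compl_sym Hl')); intros H1.
      apply H2, (proj1 (proj1 (proj2 HG) l1 (def_dom Hd)) H1), Hd.
  - destruct (classic (G l1)) as [H1 | H1].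
    + exists l1; split; auto; right; left; exists l1; auto.
    + rewrite (proj1 (proj2 HG) l1 Hd) in H1.
      apply not_all_ex_not in H1 as [l2 H2]; apply imply_to_and in H2 as [H2 H3].
      assert (C : exists l3, compl l2 l3).
      { destruct H2 as (u & i & j & e & d & b & _ & _ & _ & _ & Hk).
        assert (E : exists w, l2 = pos w \/ l2 = neg w).
        { destruct u as [|[|[|[|[|[|[|[|u]]]]]]]]; simpl in Hk; try tauto.
          - destruct Hk as (a & e' & _ & [-> | ->]); eauto.
          - eauto.
          - destruct Hk as [-> | ->]; eauto.
          - destruct Hk as (a & e' & _ & ->); eauto.
          - destruct Hk as (a & e' & _ & ->); eauto. }
        destruct E as [w [-> | ->]]; [exists (neg w) | exists (pos w)]; exists w; auto. }
      destruct C as [l3 C]; exists l3; split.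
      * right; left; exists l1; split; auto; split; auto; right; eauto.
      * apply (good_compl HG (compl_sym C)); auto.
  - destruct (classic (G (pos t))) as [H | H].
    + exists (pos t); split; auto; right; right; left; eauto.
    + exists (neg t); split; [right; right; left; eauto|].
      apply NNPP; intros H'; apply H, (proj1 HG); auto.
  - exists (pos t); split; [right; right; right; eauto|]; apply HG, Ht.
Qed.

(** [G] makes some literal of the clause true. Either it contradicts a literal of [s], which is then
    false, or adding it gives a premise whose false literal must already lie in [s]. *)
Lemma refuted_sound G s : good G -> refuted s -> exists l, ms l s /\ ~ G l.
Proof.
  intros HG Hs; induction Hs as [s r _ IH].
  destruct (classic (exists l, clause r l)) as [H | H].
  - destruct (good_clause HG H) as (l & Hl & HGl).
    destruct (classic (exists l0, ms l0 s /\ compl l l0)) as [(l0 & H0 & C) | N].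
    + exists l0; split; auto; apply (good_compl HG C), HGl.
    + destruct (IH (adj s l)) as (l' & [Hl' | ->]%ms_adj & H'); [left; eauto| |]; eauto.
      contradiction.
  (* The index of an empty disjunction has [s] itself as premise and so refutes nothing; with no
     premise at all, junk indices would refute every condition. *)
  - apply (IH s); right; auto.
Qed.

(** Both literals of the cut clause contradict [s], so it has no premise left. *)
Lemma refuted_cut s t : ms (pos t) s -> ms (neg t) s -> refuted s.
Proof.
  intros Hp Hn; apply derivable_rule with (pr (nm 2) t); intros s'.
  assert (C : forall l, clause (pr (nm 2) t) l <-> l = pos t \/ l = neg t).
  { intros l; split.
    - intros [(l1 & l2 & E & _) | [(l1 & E & _) | [(u & E & H) | (u & E & _)]]];
        apply pr_inj in E as [E1 E2]; try (apply nm_inj in E1; discriminate); subst; auto.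
    - intros H; right; right; left; eauto. }
  intros [(l & Hl & H & ->) | [H ->]].
  - destruct H; apply C in Hl as [-> | ->]; [exists (neg t) | exists (pos t)];
      split; auto; exists t; auto.
  - destruct H; exists (pos t); apply C; auto.
Qed.

Lemma prem_cut s t s' :
  prem s (pr (nm 2) t) s' -> s' = adj s (pos t) \/ s' = adj s (neg t).
Proof.
  intros [(l & Hl & _ & ->) | [H _]].
  - destruct Hl as [(l1 & l2 & E & _) | [(l1 & E & _) | [(u & E & H) | (u & E & _)]]];
      apply pr_inj in E as [E1 E2]; try (apply nm_inj in E1; discriminate); subst.
    destruct H as [-> | ->]; auto.
  - destruct H; exists (pos t); right; right; left; eauto.
Qed.

Lemma extend_clause s r : ~ refuted s -> exists s', ~ refuted s' /\
  (forall l, ms l s -> ms l s') /\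
  ((exists l, clause r l) -> exists l, clause r l /\ ms l s').
Proof.
  intros Hs.
  assert (E : exists s', prem s r s' /\ ~ refuted s').
  { apply NNPP; intros H; apply Hs, derivable_rule with r; intros s' Hs'.
    apply NNPP; intros H'; apply H; eauto. }
  destruct E as (s' & [(l & Hl & _ & ->) | [H ->]] & Hs').
  - exists (adj s l); split; auto; split; intros; [apply ms_adj; auto|].
    exists l; rewrite ms_adj; auto.
  - exists s; tauto.
Qed.

Section Semantics.

Variables (Y : V) (nu : Ms -> pt Y).
Hypothesis YM : forall A, A ∈ Y -> A ⊆ M.
Hypothesis nu_surj : forall A, exists m, nu m = A.

Notation true_lit := (true_lit model nu).

Lemma true_good :
  (forall k, ms (nm k) ax -> holds (standard_structure M Y) (decode k)) ->
  (forall n, ms n ax -> ms n om) -> good true_lit.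
Proof.
  intros Hax axom; split; [|split].
  - intros t; rewrite true_pos, true_neg; split; [tauto | apply NNPP].
  - intros l (t & i & j & e & d & b & He & Hd & -> & Hb).
    rewrite (true_kids nu YM nu_surj t i j b He Hd Hb).
    split; intros H l' Hl'; apply H; revert Hl'; apply def_kids; auto.
  - intros t (n & e & d & Hn & He & Hd & ->); rewrite true_pos.
    destruct (proj1 (ms_om model n) (axom n Hn)) as [k ->].
    apply val_stm; apply Hax, Hn.
Qed.

(** The truth lemma: the atoms determine a good valuation, by induction on [fsize]. *)
Lemma good_unique G : good G ->
  (forall a m, G (pos (atom a m)) <-> mc a (nu m)) ->
  forall k e d, isfun e -> isfun d -> G (pos (stm (nm k) e d)) <-> sat_at model nu k e d.
Proof.
  intros HG Hat.
  assert (L : forall N k e d, fsize (decode k) < N -> isfun e -> isfun d ->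
    G (pos (stm (nm k) e d)) <-> sat_at model nu k e d).
  { induction N as [|N IH]; [lia|]; intros k e d Hk He Hd.
    destruct (to_nat_cases k) as (t & i & j & ->).
    assert (S : exists b, sign model b t i j e).
    { destruct t as [|[|[|[|[|[|[|[|t]]]]]]]]; simpl; eauto;
        [destruct (classic (lookup e i = lookup e j)) |
         destruct (classic (ms (lookup e i) (lookup e j)))]; eauto. }
    destruct S as [b Hb].
    set (l := pr b (stm (nm (cantor3 t i j)) e d)).
    assert (GT : forall t, (G (pos t) <-> val model nu t) ->
      (G (pos t) <-> true_lit (pos t)) /\ (G (neg t) <-> true_lit (neg t))).
    { intros u Hu; pose proof (proj1 HG u); rewrite true_pos, true_neg; split; auto.
      destruct (classic (G (neg u))); tauto. }
    assert (E : G l <-> true_lit l).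
    { assert (Dl : dom l) by (exists t, i, j, e, d, b; auto).
      rewrite (proj1 (proj2 HG) l Dl); unfold l; rewrite (true_kids nu YM nu_surj t i j b He Hd Hb).
      assert (K : forall l', kids model t i j e d l' -> (G l' <-> true_lit l')).
      { intros l' Hl'; rewrite decode_unfold in Hk.
        assert (F : forall k e d, fsize (decode k) < N -> isfun e -> isfun d ->
          G (pos (stm (nm k) e d)) <-> val model nu (stm (nm k) e d)).
        { intros; rewrite val_stm; auto. }
        destruct t as [|[|[|[|[|[|[|[|t]]]]]]]]; simpl in Hl', Hk; try tauto.
        - destruct Hl' as (a & e' & He' & [-> | ->]); apply GT, F; auto; try apply He';
            rewrite !decode_unfold; simpl; lia.
        - subst l'; apply GT; rewrite val_atom; auto.
        - destruct Hl' as [-> | ->]; apply GT, F; auto; lia.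
        - destruct Hl' as (a & e' & He' & ->); apply GT, F; auto; try apply He'; lia.
        - destruct Hl' as (a & e' & He' & ->); apply GT, F; auto; try apply He'; lia. }
      split; intros H l' Hl'; [apply K; auto; apply H | apply K; [|apply H]];
        revert Hl'; apply def_kids; auto. }
    assert (Hb' : b = nm 0 \/ b = nm 1).
    { destruct t as [|[|[|[|[|[|[|[|t]]]]]]]]; simpl in Hb; tauto. }
    unfold l in E; rewrite <- val_stm.
    destruct Hb' as [-> | ->].
    - rewrite (proj1 HG), E, true_neg; split; [apply NNPP | tauto].
    - rewrite E, true_pos; tauto. }
  intros k e d; apply (L (S (fsize (decode k)))); lia.
Qed.

End Semantics.

Theorem omitting_model :
  countable_set M -> countable_set X -> (forall n, ms n ax -> ms n om) ->
  (forall k, ms (nm k) ax -> holds (standard_structure M X) (decode k)) ->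
  exists Y, (forall A, A ∈ Y -> A ⊆ M) /\ (exists A, A ∈ Y) /\
    (forall k, ms (nm k) ax -> holds (standard_structure M Y) (decode k)) /\
    ~ X ⊆ Y.
Proof.
  intros [f Hf] [g Hg] axom Hax.
  pose proof (proj1 (proj2 (proj2 (proj2 model)))) as [A0]; change (pt X) in A0.
  assert (enumM : exists h : nat -> Ms, forall x, exists n, h n = x).
  { exists (fun n => epsilon (inhabits (nm 0)) (fun x => proj1_sig x = f n)).
    intros x; destruct (Hf _ (proj2_sig x)) as [n Hn]; exists n; apply sig_eq.
    rewrite Hn; apply (epsilon_spec (inhabits (nm 0)) (fun x => proj1_sig x = f n)); eauto. }
  destruct enumM as [h Hh].
  (* The model (M, X), its classes named by numerals, is itself a valuation. *)
  assert (cons : ~ refuted (nm 0)).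
  { set (nu (m : Ms) := epsilon (inhabits A0)
      (fun A : pt X => exists n, m = nm n /\ proj1_sig A = g n)).
    assert (Hnu : forall A, exists m, nu m = A).
    { intros A; destruct (Hg _ (proj2_sig A)) as [n Hn]; exists (nm n); apply sig_eq.
      destruct (epsilon_spec (inhabits A0)
        (fun A : pt X => exists k, nm n = nm k /\ proj1_sig A = g k)) as (k & E & Hk); [eauto|].
      apply nm_inj in E as <-; unfold nu; rewrite Hk; auto. }
    intros H; destruct (refuted_sound (true_good nu (proj1 (proj2 model)) Hnu Hax axom) H)
      as (l & Hl & _); exact (ms_nm0 Hl). }
  destruct (stage_comparison model prem D_prem) as (Q & HQ & Q1 & Q2).
  (* The diagonal: the pair (s, m) is itself the point where the omitted class and the class named
     [m] are made to differ. *)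
  set (Acl (a : Ms) := exists s m, a = pr s m /\ ~ Q (adj s (neg (atom a m))) s).
  destruct (@comprehension_class M X model Acl) as [A HA].
  { unfold Acl; dauto; apply HQ; dauto. }
  assert (omit : forall s m, ~ refuted s -> exists s', ~ refuted s' /\
    (forall l, ms l s -> ms l s') /\
    exists a, (mc a A /\ ms (neg (atom a m)) s') \/ (~ mc a A /\ ms (pos (atom a m)) s')).
  { intros s m Hs; set (a := pr s m).
    assert (E : mc a A <-> ~ Q (adj s (neg (atom a m))) s).
    { rewrite HA; unfold Acl; split.
      - intros (s' & m' & E & H); apply pr_inj in E as [<- <-]; exact H.
      - intros H; exists s, m; auto. }
    (* For a in A, refuting s ∪ {a ∉ m} would put it two stages before s. For a not in A it is two
       stages before s, so s ∪ {a ∈ m} is not, and hence is not refuted. *)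
    destruct (classic (mc a A)) as [Ha | Ha].
    - exists (adj s (neg (atom a m))); split; [|split].
      + intros H; apply (proj1 E Ha), Q1; auto.
      + intros; apply ms_adj; auto.
      + exists a; left; split; auto; apply ms_adj; auto.
    - exists (adj s (pos (atom a m))); split; [|split].
      + intros H; apply Ha, E; intros H'.
        apply (Q2 s (pr (nm 2) (atom a m)) _ _ (@prem_cut s (atom a m))); auto.
      + intros; apply ms_adj; auto.
      + exists a; right; split; auto; apply ms_adj; auto. }
  (* One enumeration of M serves twice: [h n] is first a clause index and then a name. Conditions
     only grow, so what is achieved persists. *)
  assert (step : forall n (s : {s | ~ refuted s}), exists s' : {s | ~ refuted s},
    (forall l, ms l (proj1_sig s) -> ms l (proj1_sig s')) /\
    ((exists l, clause (h n) l) -> exists l, clause (h n) l /\ ms l (proj1_sig s')) /\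
    exists a, (mc a A /\ ms (neg (atom a (h n))) (proj1_sig s')) \/
      (~ mc a A /\ ms (pos (atom a (h n))) (proj1_sig s'))).
  { intros n [s Hs]; destruct (extend_clause (h n) Hs) as (s1 & H1 & I1 & C1).
    destruct (omit s1 (h n) H1) as (s2 & H2 & I2 & C2).
    exists (exist _ s2 H2); simpl; split; [auto|]; split; auto.
    intros Hc; destruct (C1 Hc) as (l & Hl & Hl'); eauto. }
  set (next n s := proj1_sig (constructive_indefinite_description _ (step n s))).
  set (chain := fix chain n := match n with
    | 0 => exist (fun s => ~ refuted s) (nm 0) cons
    | S n => next n (chain n) end).
  assert (Hnext : forall n, _) by
    (intros n; exact (proj2_sig (constructive_indefinite_description _ (step n (chain n))))).
  change (forall n, (forall l, ms l (proj1_sig (chain n)) -> ms l (proj1_sig (chain (S n)))) /\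
    ((exists l, clause (h n) l) ->
      exists l, clause (h n) l /\ ms l (proj1_sig (chain (S n)))) /\
    exists a, (mc a A /\ ms (neg (atom a (h n))) (proj1_sig (chain (S n)))) \/
      (~ mc a A /\ ms (pos (atom a (h n))) (proj1_sig (chain (S n))))) in Hnext.
  assert (mono : forall m n l, m <= n ->
    ms l (proj1_sig (chain m)) -> ms l (proj1_sig (chain n))).
  { intros m n l L H; induction L; auto; apply Hnext; auto. }
  set (G l := exists n, ms l (proj1_sig (chain n))).
  assert (Gcl : forall r, (exists l, clause r l) -> exists l, clause r l /\ G l).
  { intros r Hr; destruct (Hh r) as [n <-].
    destruct (proj1 (proj2 (Hnext n)) Hr) as (l & Hl & H); exists l; split; auto; eexists; eauto. }
  assert (Gcons : forall t, G (pos t) -> G (neg t) -> False).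
  { intros t [m Hm] [n Hn]; apply (proj2_sig (chain (max m n))), refuted_cut with t;
      eapply mono; eauto with arith. }
  assert (Gcompl : forall l l', compl l l' -> G l -> ~ G l').
  { intros l l' (t & [[-> ->] | [-> ->]]) H H'; eauto. }
  assert (GG : good G).
  { split; [|split].
    - intros t; split; [intros H H'; eauto|]; intros H.
      destruct (Gcl (pr (nm 2) t)) as (l & Hl & HGl).
      { exists (pos t); right; right; left; eauto. }
      destruct Hl as [(l1 & l2 & E & _) | [(l1 & E & _) | [(u & E & Hu) | (u & E & _)]]];
        apply pr_inj in E as [E1 E2]; try (apply nm_inj in E1; discriminate); subst.
      destruct Hu as [-> | ->]; [auto | contradiction].
    - intros l Hl; split.
      + intros HGl l' Hd; destruct (Gcl (pr (nm 0) (pr l l'))) as (l2 & Hl2 & HG2).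
        { exists l'; left; eauto 6. }
        destruct Hl2 as [(u & v & E & _ & Hu) | [(u & E & _) | [(u & E & _) | (u & E & _)]]];
          apply pr_inj in E as [E1 E2]; try (apply nm_inj in E1; discriminate).
        apply pr_inj in E2 as [<- <-]; destruct Hu as [C | ->]; auto.
        destruct (Gcompl _ _ C HGl HG2).
      + intros H; destruct (Gcl (pr (nm 1) l)) as (l2 & Hl2 & HG2).
        { exists l; right; left; eauto 6. }
        destruct Hl2 as [(u & v & E & _) | [(u & E & _ & Hu) | [(u & E & _) | (u & E & _)]]];
          apply pr_inj in E as [E1 E2]; try (apply nm_inj in E1; discriminate).
        subst u; destruct Hu as [-> | (l' & Hd & C)]; auto.
        destruct (Gcompl _ _ C (H l' Hd) HG2).
    - intros t Ht; destruct (Gcl (pr (nm 3) t)) as (l2 & Hl2 & HG2).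
      { exists (pos t); right; right; right; eauto. }
      destruct Hl2 as [(u & v & E & _) | [(u & E & _) | [(u & E & _) | (u & E & _ & Hu)]]];
        apply pr_inj in E as [E1 E2]; try (apply nm_inj in E1; discriminate).
      subst; exact HG2. }
  assert (Hy : forall m : Ms, exists y, forall z,
    z ∈ y <-> z ∈ M /\ exists a, proj1_sig a = z /\ G (pos (atom a m))).
  { intros m; apply separation_exists. }
  set (y m := proj1_sig (constructive_indefinite_description _ (Hy m))).
  assert (Ey : forall m z, z ∈ y m <-> z ∈ M /\ exists a, proj1_sig a = z /\ G (pos (atom a m))).
  { intros m; exact (proj2_sig (constructive_indefinite_description _ (Hy m))). }
  assert (Ey' : forall m (a : Ms), proj1_sig a ∈ y m <-> G (pos (atom a m))).
  { intros m a; rewrite Ey; split.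
    - intros [_ (b & E & H)]; apply sig_eq in E as <-; exact H.
    - intros H; split; [apply proj2_sig | eauto]. }
  destruct (pt_image y) as [Y HY].
  set (nu m := exist (fun A => A ∈ Y) (y m) (proj2 (HY (y m)) (ex_intro _ m eq_refl))).
  assert (nu_surj : forall B, exists m, nu m = B).
  { intros [B HB]; destruct (proj1 (HY B) HB) as [m Hm]; exists m; apply sig_eq; auto. }
  assert (YM : forall B, B ∈ Y -> B ⊆ M).
  { intros B [m ->]%HY z Hz; apply Ey in Hz; tauto. }
  exists Y; split; [exact YM|]; split; [|split].
  - exists (y (nm 0)); apply HY; eauto.
  - intros k Hk s c.
    set (c' j := epsilon (inhabits (nm 0)) (fun m => nu m = c j)).
    assert (Hc' : forall j, nu (c' j) = c j).
    { intros j; apply (epsilon_spec (inhabits (nm 0)) (fun m => nu m = c j)), nu_surj. }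
    (* The external assignments are cut to finite parts that lie in M; [N] exceeds every free
       variable. *)
    set (N := S (list_max (fvS (decode k)) + list_max (fvC (decode k)))).
    destruct (fun_exists model s N) as (e & He & Ee).
    destruct (fun_exists model c' N) as (d & Hd & Ed).
    assert (T : sat_at model nu k e d).
    { apply (good_unique nu YM nu_surj GG); auto.
      - intros a m; rewrite <- Ey'; reflexivity.
      - apply GG; exists (nm k), e, d; auto. }
    revert T; apply sat_agree.
    + intros j Hj%in_list_max; symmetry; apply Ee; unfold N; lia.
    + intros j Hj%in_list_max; symmetry; rewrite Ed by (unfold N; lia); apply Hc'.
  - intros H; destruct (proj1 (HY (proj1_sig A)) (H _ (proj2_sig A))) as [m Hm].
    destruct (Hh m) as [n <-]; destruct (Hnext n) as (_ & _ & a & [[H1 H2] | [H1 H2]]).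
    + unfold mc in H1; rewrite Hm in H1; apply Ey' in H1.
      apply (Gcons _ H1); eexists; eauto.
    + apply H1; unfold mc; rewrite Hm; apply Ey'; eexists; eauto.
Qed.

End Generic.

(** * Computable sets belong to the model *)

Lemma murec_nested_ind (P : murec -> Prop) :
  P Zero -> P Succ -> (forall i, P (Proj i)) ->
  (forall f gs, P f -> Forall P gs -> P (Comp f gs)) ->
  (forall f g, P f -> P g -> P (PrimRec f g)) ->
  (forall f, P f -> P (Mu f)) -> forall f, P f.
Proof.
  intros H0 HS HP HC HR HM; fix IH 1; intros [| |i|f gs|f g|f].
  - exact H0.
  - exact HS.
  - apply HP.
  - apply HC; [apply IH|]; induction gs as [|g gs IHgs]; constructor; [apply IH | apply IHgs].
  - apply HR; apply IH.
  - apply HM; apply IH.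
Qed.

Lemma evals_functional f : forall v y y', evals f v y -> evals f v y' -> y = y'.
Proof.
  induction f as [| |i|f gs IHf IHgs|f g IHf IHg|f IHf] using murec_nested_ind;
    intros v y y' H H'.
  - inversion H; inversion H'; congruence.
  - inversion H; inversion H'; congruence.
  - inversion H; inversion H'; congruence.
  - inversion H as [| | |? ? ? ys ? F E| | |]; inversion H' as [| | |? ? ? ys' ? F' E'| | |]; subst.
    assert (ys = ys') as <-; [|eauto].
    clear - IHgs F F'; revert ys ys' F F'; induction IHgs as [|g gs Hg _ IH];
      intros ys ys' F F'; inversion F; inversion F'; subst; auto; f_equal; eauto.
  - assert (L : forall n v y y', evals (PrimRec f g) (n :: v) y ->
      evals (PrimRec f g) (n :: v) y' -> y = y').
    { clear - IHf IHg; induction n as [|n IHn]; intros v y y' H H';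
        inversion H; inversion H'; subst; eauto.
      match goal with A : evals (PrimRec f g) _ ?a, B : evals (PrimRec f g) _ ?b |- _ =>
        assert (a = b) as <- by eauto end; eauto. }
    destruct v; [inversion H | eauto].
  - inversion H as [| | | | | |? ? n h A B]; inversion H' as [| | | | | |? ? n' h' A' B']; subst.
    destruct (Nat.lt_trichotomy y y') as [L | [L | L]]; auto.
    + discriminate (IHf _ _ _ B (A' _ L)).
    + discriminate (IHf _ _ _ B' (A _ L)).
Qed.

Section Computable.

Variables M X : V.
Hypothesis model : Pi11_model M X.

Notation Ms := (pt M).
Notation pr := (pr model).
Notation adj := (adj model).
Notation nm := (nm model).
Notation om := (om model).
Notation D := (@D M X).
Notation Tm := (@Tm M X).
Notation D2 := (@D2 M X).

Fixpoint venc (v : list nat) : Ms :=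
  match v with [] => nm 0 | x :: v => pr (nm x) (venc v) end.

Lemma pr_neq0 x y : nm 0 <> pr x y.
Proof.
  intros E; apply (@ms_nm0 M X model (upair model x x)); rewrite E.
  apply ms_upair; auto.
Qed.

(** Nothing is said about arguments that are not encodings or values that are not numerals;
    intermediate values are therefore restricted to ω. *)
Definition represents (R : Ms -> Ms -> Prop) (f : murec) : Prop :=
  forall v y, R (venc v) (nm y) <-> evals f v y.

(** Choice trades the function in [ev_mu] for an existential quantifier, which the model can
    express. *)
Lemma evals_Mu f v n : evals (Mu f) v n <->
  (forall m, m < n -> exists y, evals f (m :: v) (S y)) /\ evals f (n :: v) 0.
Proof.
  split.
  - intros H; inversion H; subst; split; eauto.
  - intros [H1 H2]; apply ev_mu with (fun m => epsilon (inhabits 0)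
      (fun y => evals f (m :: v) (S y))); auto.
    intros m Hm; apply (epsilon_spec (inhabits 0) (fun y => evals f (m :: v) (S y))); auto.
Qed.

Lemma representable f : exists R, D2 R /\ represents R f.
Proof.
  induction f as [| |i|f gs [Rf [DRf HRf]] IHgs|f g [Rf [DRf HRf]] [Rg [DRg HRg]]|
    f [Rf [DRf HRf]]] using murec_nested_ind.
  - exists (fun v y => y = nm 0); split; [intros k t u Ht Hu; dauto|].
    intros v y; split; [intros ->%nm_inj; constructor | intros H; inversion H; auto].
  - exists (fun v y => exists x w, v = pr x w /\ y = adj x x); split.
    { intros k t u Ht Hu; dauto. }
    intros v y; split.
    + intros (x & w & E & Ey); destruct v as [|n v]; simpl in E.
      { apply pr_neq0 in E as []. }
      apply pr_inj in E as [<- _]; rewrite <- nm_S in Ey; apply nm_inj in Ey as ->.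
      constructor.
    + intros H; inversion H; subst; simpl; rewrite nm_S; eauto.
  - induction i as [|i (R & DR & HR)].
    + exists (fun v y => exists w, v = pr y w); split; [intros k t u Ht Hu; dauto|].
      intros v y; split.
      * intros (w & E); destruct v as [|n v]; simpl in E; [apply pr_neq0 in E as []|].
        apply pr_inj in E as [->%nm_inj _]; constructor; auto.
      * intros H; inversion H; subst; destruct v as [|n v]; try discriminate.
        simpl in *; exists (venc v); congruence.
    + exists (fun v y => exists x w, v = pr x w /\ R w y); split.
      { intros k t u Ht Hu; dauto; apply DR; dauto. }
      intros v y; split.
      * intros (x & w & E & H); destruct v as [|n v]; simpl in E; [apply pr_neq0 in E as []|].
        apply pr_inj in E as [_ <-]; apply HR in H; inversion H; constructor; auto.
      * intros H; inversion H; subst; destruct v as [|n v]; try discriminate.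
        simpl; exists (nm n), (venc v); split; auto; apply HR; constructor; auto.
  - assert (L : exists R, D2 R /\ forall v w, R (venc v) w <->
      exists ys, w = venc ys /\ Forall2 (fun g y => evals g v y) gs ys).
    { induction IHgs as [|g gs (Rg & DRg & HRg) _ (R & DR & HR)].
      - exists (fun v w => w = nm 0); split; [intros k t u Ht Hu; dauto|].
        intros v w; split.
        + intros ->; exists []; auto.
        + intros (ys & -> & H); inversion H; auto.
      - exists (fun v w => exists y w', w = pr y w' /\ ms y om /\ Rg v y /\ R v w'); split.
        { intros k t u Ht Hu; dauto; first [apply DRg | apply DR]; dauto. }
        intros v w; split.
        + intros (y & w' & -> & Hy & H1 & H2); apply ms_om in Hy as [n ->].
          apply HR in H2 as (ys & -> & H2); apply HRg in H1; exists (n :: ys); auto.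
        + intros (ys & -> & H); inversion H as [|? n ? ys' Hg Hgs]; subst.
          exists (nm n), (venc ys'); split; auto; split; [apply nm_om|].
          split; [apply HRg; auto | apply HR; eauto]. }
    destruct L as (R & DR & HR).
    exists (fun v y => exists w, R v w /\ Rf w y); split.
    { intros k t u Ht Hu; dauto; first [apply DRf | apply DR]; dauto. }
    intros v y; split.
    + intros (w & (ys & -> & H)%HR & Hf%HRf); econstructor; eauto.
    + intros H; inversion H as [| | |? ? ? ys ? F E| | |]; subst; exists (venc ys).
      split; [apply HR; eauto | apply HRf; auto].
  - (* As for [cantor_graph]: d is a finite record of the recursion. *)
    exists (fun v y => exists n w, v = pr n w /\ exists d, ms (pr n y) d /\
      forall m z, ms (pr m z) d -> ms z om /\
        ((m = nm 0 /\ Rf w z) \/ exists m' z', ms m' om /\ m = adj m' m' /\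
          ms (pr m' z') d /\ Rg (pr m' (pr z' w)) z)); split.
    { intros k t u Ht Hu; dauto; first [apply DRf | apply DRg]; dauto. }
    intros v y; split.
    + intros (n & w & E & d & Hd & Hc); destruct v as [|n' v]; simpl in E;
        [apply pr_neq0 in E as []|].
      apply pr_inj in E as [<- <-]; revert y Hd; induction n' as [|n IH]; intros y Hd.
      * destruct (Hc _ _ Hd) as [_ [[_ H] | (m' & z' & _ & E & _)]].
        { constructor; apply HRf, H. }
        destruct (adj_nm_inv _ E) as (j & _ & E'); discriminate.
      * destruct (Hc _ _ Hd) as [_ [[E _] | (m' & z' & _ & E & Hd' & H)]].
        { apply nm_inj in E; discriminate. }
        destruct (adj_nm_inv _ E) as (j & -> & [= <-]).
        destruct (Hc _ _ Hd') as [Hz _]; apply ms_om in Hz as [z ->].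
        apply ev_primS with z; auto; apply HRg, H.
    + intros H; destruct v as [|n v]; [inversion H|].
      exists (nm n), (venc v); split; auto.
      revert y H; induction n as [|n IH]; intros y H; inversion H; subst.
      * exists (adj (nm 0) (pr (nm 0) (nm y))); split; [apply ms_adj; auto|].
        intros m z [[]%ms_nm0 | [-> ->]%pr_inj]%ms_adj; split; [apply nm_om|].
        left; split; auto; apply HRf; auto.
      * match goal with A : evals (PrimRec f g) _ ?a |- _ =>
          destruct (IH a A) as (d & Hd & Hc); rename a into z end.
        exists (adj d (pr (nm (S n)) (nm y))); split; [apply ms_adj; auto|].
        intros m x [Hm | [-> ->]%pr_inj]%ms_adj.
        { destruct (Hc m x Hm) as [Hx [H1 | (m' & z' & H1 & H2 & H3 & H4)]]; split; auto.
          right; exists m', z'; rewrite ms_adj; auto 6. }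
        split; [apply nm_om|]; right; exists (nm n), (nm z); split; [apply nm_om|].
        rewrite nm_S, ms_adj; split; auto; split; auto.
        apply (HRg (n :: z :: v)); auto.
  - exists (fun v y => ms y om /\ (forall m, ms m y -> exists z, ms z om /\
      Rf (pr m v) (adj z z)) /\ Rf (pr y v) (nm 0)); split.
    { intros k t u Ht Hu; dauto; apply DRf; dauto. }
    intros v n; rewrite evals_Mu, (HRf (n :: v)); split.
    + intros (_ & H & H0); split; auto; intros m Hm.
      destruct (H (nm m)) as (z & Hz & HR); [apply ms_nm; eauto|].
      apply ms_om in Hz as [k ->]; rewrite <- nm_S in HR; exists k; apply HRf, HR.
    + intros [H H0]; split; [apply nm_om|]; split; auto.
      intros m (k & Hk & ->)%ms_nm; destruct (H k Hk) as [z Hz].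
      exists (nm z); split; [apply nm_om|]; rewrite <- nm_S; apply (HRf (k :: v)), Hz.
Qed.

Lemma nat_set_mem (P : nat -> Prop) (Q : Ms -> Prop) :
  (forall k t, Tm k t -> D k (fun Z s => Q (t s))) ->
  (forall n, Q (nm n) <-> P n) -> nat_set P ∈ M.
Proof.
  intros HQ H; destruct (separation model Q om HQ) as [b Hb].
  replace (nat_set P) with (proj1_sig b); [apply proj2_sig|].
  apply set_ext; intros z; rewrite mem_nat_set; split.
  - intros Hz; destruct (ms_cases model b Hz) as [w <-]; apply Hb in Hz as [Hw HQw].
    apply ms_om in Hw as [n ->]; exists n; split; auto; apply H, HQw.
  - intros (n & Hn & ->); apply (Hb (nm n)); split; [apply nm_om | apply H, Hn].
Qed.

Lemma computable_mem P : computable P -> nat_set P ∈ M.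
Proof.
  intros [f Hf]; destruct (representable f) as (R & DR & HR).
  apply nat_set_mem with (fun x => R (pr x (nm 0)) (nm 1)).
  - intros k t Ht; apply DR; dauto.
  - intros n; rewrite (HR [n] 1); split; [|apply Hf].
    intros H; apply NNPP; intros H'; apply (proj2 (Hf n)) in H'.
    discriminate (evals_functional H H').
Qed.

End Computable.

(** * Kelley–Morse set theory *)

(* The comprehension instance for [decode n] over the variable x, naming the class by the
   variable n, which is not free in [decode n]. *)
Definition comp_instance (x n : nat) : form :=
  ExistsC n (ForallS x (Iff (MemC x n) (decode n))).

Notation cantor3 t i j := (to_nat (t, to_nat (i, j))).

(** As [n] codes [decode n], the instance arises from [x] and [n] by finitely many pairings, without
    recursion on formulas. *)
Definition comp_code (x n : nat) : nat :=
  let imp i j := cantor3 5 i j in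
  let bot := cantor3 4 0 0 in
  let m := cantor3 3 x n in
  imp (cantor3 7 n (imp (cantor3 6 x
    (imp (imp (imp m n) (imp (imp n m) bot)) bot)) bot)) bot.

Lemma decode_comp_code x n : decode (comp_code x n) = comp_instance x n.
Proof. unfold comp_code; rewrite !decode_unfold; reflexivity. Qed.

(** With M fixed, the rest of KM is inherited: ZF speaks of sets only, and class extensionality
    holds for any family of subsets of M. Universal closures need no code, since [holds] ranges over
    all assignments. *)
Definition KM_code (k : nat) : Prop :=
  k = code ax_class_replacement \/ exists x n, k = comp_code x n.

Lemma KM_code_mem M X : Pi11_model M X -> nat_set KM_code ∈ M.
Proof.
  intros model.
  set (imp i j := cp model (nm model 5) (cp model i j)).
  set (bot := nm model (cantor3 4 0 0)).
  set (comp x n :=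
    let m := cp model (nm model 3) (cp model x n) in
    imp (cp model (nm model 7) (cp model n (imp (cp model (nm model 6) (cp model x
      (imp (imp (imp m n) (imp (imp n m) bot)) bot))) bot))) bot).
  assert (E : forall x n, comp (nm model x) (nm model n) = nm model (comp_code x n)).
  { intros x n; unfold comp, imp, bot; rewrite !cp_nm; reflexivity. }
  apply (@nat_set_mem M X model KM_code (fun k => k = nm model (code ax_class_replacement) \/
    exists x n, ms x (om model) /\ ms n (om model) /\ k = comp x n)).
  - intros k t Ht; unfold comp, imp; dauto.
  - intros k; unfold KM_code; split.
    + intros [->%nm_inj | (x & n & Hx & Hn & H)]; auto.
      apply ms_om in Hx as [x' ->]; apply ms_om in Hn as [n' ->].
      rewrite E in H; apply nm_inj in H; eauto.
    + intros [-> | (x & n & ->)]; auto; right; exists (nm model x), (nm model n).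
      rewrite E; auto using nm_om.
Qed.

Lemma sat_set_form M X Y p : elementary p -> fvC p = [] ->
  forall s (c : nat -> pt X) (c' : nat -> pt Y),
  sat (standard_structure M X) s c p <-> sat (standard_structure M Y) s c' p.
Proof.
  induction p as [x y|A B|x y|x A| |p IHp q IHq|x p IHp|A p IHp];
    simpl; intros E F s c c'; try tauto; try discriminate.
  - apply app_eq_nil in F; rewrite (IHp ltac:(tauto) ltac:(tauto) s c c'),
      (IHq ltac:(tauto) ltac:(tauto) s c c'); tauto.
  - split; intros H a; apply (IHp E F _ c c'); auto.
Qed.

Lemma close_set_form p : set_form p -> set_form (close p).
Proof.
  intros [E F]; unfold close; rewrite F; simpl; generalize (fvS p); intros l.
  induction l as [|x l IH]; split; simpl; auto; apply IH.
Qed.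

Lemma ZF_set_form p : ZF p -> set_form p.
Proof.
  intros []; try (split; simpl; tauto); apply close_set_form; split; simpl;
    destruct H as [E F]; rewrite ?F; simpl; tauto.
Qed.

Lemma KM_extends : extends KM GB_Pi11_CA.
Proof.
  intros p Hp S (_ & _ & H); apply H; destruct Hp as [Hp | Hp]; [left; auto | right].
  destruct Hp; constructor; auto.
Qed.

Lemma KM_models_codes S k : models S KM -> KM_code k -> holds S (decode k).
Proof.
  intros (_ & _ & H) [-> | (x & n & ->)].
  - rewrite decode_code; apply H; left; constructor 3.
  - rewrite decode_comp_code; apply holds_close, H; right; constructor; auto.
    intros L%fvC_decode; lia.
Qed.

Lemma codes_models_KM M X Y p : (forall B, B ∈ Y -> B ⊆ M) ->
  models (standard_structure M X) KM ->
  (forall k, KM_code k -> holds (standard_structure M Y) (decode k)) ->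
  KM p -> holds (standard_structure M Y) p.
Proof.
  intros YM (_ & [A0] & HX) HY.
  assert (comp : forall Phi p, comprehension Phi p -> holds (standard_structure M Y) p).
  { intros Phi q [x A r _ HA]; apply holds_close; intros s c.
    assert (C : KM_code (comp_code x (code r))) by (right; eauto).
    apply HY in C; rewrite decode_comp_code in C; unfold comp_instance in C.
    assert (F := fun A => @fvC_decode (code r) A); rewrite decode_code in C, F.
    specialize (C s c); rewrite sat_ExistsC in C |- *; destruct C as [B HB]; exists B; intros a.
    specialize (HB a); rewrite sat_Iff in HB |- *; cbn [sat] in HB |- *.
    rewrite !upd_eq in *; rewrite HB; apply sat_agree; auto.
    intros W HW; rewrite !upd_neq; auto; [congruence|].
    specialize (F W HW); lia. }
  intros [[q Z| | |q Hq] | Hp]; eauto.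
  - intros s c; apply (@sat_set_form M X Y q) with (c := fun _ => A0); try apply (ZF_set_form Z).
    apply HX; left; constructor; exact Z.
  - intros s c A B H; simpl; apply sig_eq, set_ext; intros z; split; intros Hz.
    + assert (zM : z ∈ M) by exact (YM _ (proj2_sig A) z Hz).
      specialize (H (exist _ z zM)); apply sat_Iff in H; exact (proj1 H Hz).
    + assert (zM : z ∈ M) by exact (YM _ (proj2_sig B) z Hz).
      specialize (H (exist _ z zM)); apply sat_Iff in H; exact (proj2 H Hz).
  - rewrite <- (decode_code ax_class_replacement); apply HY; left; auto.
Qed.

(** * Nonexistence of minimum models *)

Lemma transitive_model_Pi11 T M X :
  extends T GB_Pi11_CA -> transitive_model T M X -> Pi11_model M X.
Proof.
  intros ext (Mtr & XM & HT); split; auto; split; auto; split; [apply HT|].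
  split; [apply HT|]; intros p Hp; exact (ext p Hp _ HT).
Qed.

(** [C] has to axiomatize T only over the fixed M, which covers both a theory coded in M and the
    reduced axioms of KM. The omitting model keeps M, hence [r], and so contradicts minimality. *)
Lemma no_minimum T M X r (C : nat -> Prop) :
  extends T GB_Pi11_CA -> transitive_model T M X -> r ∈ M -> r ⊆ omega ->
  (forall N Y, transitive_model T N Y -> r ∈ N -> M ⊆ N /\ X ⊆ Y) ->
  nat_set C ∈ M ->
  (forall k, C k -> holds (standard_structure M X) (decode k)) ->
  (forall Y, (forall A, A ∈ Y -> A ⊆ M) -> inhabited (pt Y) ->
    (forall k, C k -> holds (standard_structure M Y) (decode k)) ->
    forall p, T p -> holds (standard_structure M Y) p) -> False.
Proof.
  intros ext TM rM rom min CM HX HY.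
  assert (model := transitive_model_Pi11 ext TM).
  destruct (TM) as (Mtr & _ & inM & _).
  destruct (countable_transitive_model TM rM rom) as (N & Y & TN & rN & cN & cY).
  { rewrite <- (om_omega model); intros z Hz; destruct (ms_cases model (om model) Hz) as [w <-].
    apply proj2_sig. }
  destruct (min N Y TN rN) as [MN XY].
  assert (cM : countable_set M) by (destruct cN as [f Hf]; exists f; auto).
  assert (cX : countable_set X) by (destruct cY as [f Hf]; exists f; auto).
  set (ax := exist _ (nat_set C) CM : pt M).
  assert (Hax : forall k, ms (nm model k) ax <-> C k).
  { intros k; unfold ms; simpl; rewrite mem_nat_set; split.
    - intros (n & Hn & ->%num_inj); auto.
    - eauto. }
  destruct (@omitting_model M X model ax cM cX) as (W & WM & [A HA] & HW & NW).
  - intros n Hn; apply ms_om; apply mem_nat_set in Hn as (k & _ & E); exists k.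
    apply sig_eq, E.
  - intros k Hk; apply HX, Hax, Hk.
  - apply NW, (min M W); auto; split; auto; split; auto; split; auto.
    split; [constructor; exists A; auto|]; apply HY; auto; [constructor; exists A; auto|].
    intros k Hk; apply HW, Hax, Hk.
Qed.

(** The empty set is a real that lies in every transitive model of T. *)
Lemma no_minimum_of_containing T : extends T GB_Pi11_CA ->
  (forall r, r ⊆ omega -> no_minimum_transitive_model_containing T r) ->
  no_minimum_transitive_model T /\
  forall r : V, r ⊆ omega -> no_minimum_transitive_model_containing T r.
Proof.
  intros ext H; split; auto; intros (M & X & HM & min).
  apply (H (num 0)); [intros z []%mem_num0|].
  exists M, X; split; auto; split; auto.
  exact (num_mem (transitive_model_Pi11 ext HM) 0).
Qed.

(** [A] may differ from [T]: a computably axiomatizable theory need not have a computable set of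
    codes itself. *)
Lemma no_minimum_codes_mem T : extends T GB_Pi11_CA ->
  (forall M X, transitive_model T M X -> exists A, code_set A ∈ M /\
    forall S, models S A <-> models S T) ->
  no_minimum_transitive_model T /\
  forall r : V, r ⊆ omega -> no_minimum_transitive_model_containing T r.
Proof.
  intros ext HA; apply no_minimum_of_containing; auto.
  intros r rom (M & X & TM & rM & min).
  destruct (HA M X TM) as (A & AM & E).
  apply (@no_minimum T M X r (codes A)); auto.
  - intros k (p & Hp & <-); rewrite decode_code.
    apply (proj2 (E _) (proj2 (proj2 TM))), Hp.
  - intros Y YM inY HY; apply (proj1 (E (standard_structure M Y))).
    split; [constructor; exists r; auto|]; split; auto.
    intros p Hp; rewrite <- (decode_code p); apply HY; exists p; auto.
Qed.

Theorem theorem3 :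
  (no_minimum_transitive_model KM /\
   forall r : V, r ⊆ omega -> no_minimum_transitive_model_containing KM r) /\
  (forall T : form -> Prop,
     theory T -> extends T GB_Pi11_CA ->
     (forall M X : V, transitive_model T M X -> code_set T ∈ M) ->
     no_minimum_transitive_model T /\
     forall r : V, r ⊆ omega -> no_minimum_transitive_model_containing T r) /\
  (forall T : form -> Prop,
     theory T -> extends T GB_Pi11_CA -> computably_axiomatizable T ->
     no_minimum_transitive_model T /\
     forall r : V, r ⊆ omega -> no_minimum_transitive_model_containing T r).
Proof.
  split; [|split].
  - apply no_minimum_of_containing; [exact KM_extends|].
    intros r rom (M & X & TM & rM & min).
    apply (@no_minimum KM M X r KM_code); auto using KM_extends.
    + exact (KM_code_mem (transitive_model_Pi11 KM_extends TM)).
    + intros k Hk; apply KM_models_codes; auto; apply TM.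
    + intros Y YM _ HY p Hp; apply (@codes_models_KM M X Y p); auto; apply TM.
  - intros T _ ext HT; apply no_minimum_codes_mem; auto.
    intros M X TM; exists T; split; [eauto | tauto].
  - intros T thT ext (A & thA & cA & E); apply no_minimum_codes_mem; auto.
    intros M X TM; exists A; split; [exact (computable_mem (transitive_model_Pi11 ext TM) cA)|].
    intros S; split; intros (i1 & i2 & H); split; auto; split; auto; intros p Hp.
    + apply (proj2 (E p (thT p Hp))); [|split; auto]. intros S' H'; apply H', Hp.
    + apply (proj1 (E p (thA p Hp))); [|split; auto]. intros S' H'; apply H', Hp.
Qed.
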